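(* The algebra $\mathcal{A}_\Lambda$ is a quotient of $\mathfrak{S}_2\ltimes\mathcal{U}(\mathfrak{osp}(2,2))$, and the Casimir operator of $\mathfrak{osp}(2,2)$ vanishes in this quotient; that is, there is a surjective algebra homomorphism $\mathfrak{S}_2\ltimes\mathcal{U}(\mathfrak{osp}(2,2))\to\mathcal{A}_\Lambda$ which sends the Casimir element of $\mathcal{U}(\mathfrak{osp}(2,2))$ to $0$.
   Context: All algebras are unital associative over $\mathbb{C}$. $\mathcal{A}_\Lambda$ is the algebra with generators $\omega_1,E_+,E_-,\Lambda$ and relations: $\Lambda$ is central, $\omega_1^2=1$, $E_\pm\omega_1=-\omega_1E_\pm$, $E_+E_--E_-E_+=-\frac14+\Lambda\omega_1$. $\mathfrak{osp}(2,2)$ is the orthosymplectic Lie superalgebra over $\mathbb{C}$ of a superspace of dimension $(2|2)$, and $\mathcal{U}(\mathfrak{osp}(2,2))$ is its enveloping algebra with natural $\mathbb{Z}_2$-gradation. The Casimir element is the quadratic Casimir element of $\mathcal{U}(\mathfrak{osp}(2,2))$ associated with the non-degenerate invariant supersymmetric even bilinear form (unique up to a scalar). For a $\mathbb{Z}_2$-graded algebra $A$, $\mathfrak{S}_2\ltimes A$ is the smash product: the algebra generated by $A$ and an element $P$ with $P^2=1$ and $Pa=(-1)^{\deg a}aP$ for homogeneous $a\in A$ (with underlying space $A\otimes\mathbb{C}[\mathfrak{S}_2]$). *)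

(* Defs.v *)
From HB Require Import structures.
From mathcomp Require Import all_boot all_order all_algebra ring.
From mathcomp Require Import finmap complex monalg.
From mathcomp Require Import boolp reals.

Set Implicit Arguments.
Unset Strict Implicit.
Unset Printing Implicit Defensive.

Import GRing.Theory Num.Theory.
Local Open Scope ring_scope.
Local Open Scope quotient_scope.

(* Free associative unital algebra on a set X: the monoid algebra of the free
   monoid of words in X. *)
Definition freeAlg (K : fieldType) (X : choiceType) := {malg K[{fmonom X}]}.

HB.instance Definition _ (K : fieldType) (X : choiceType) :=
  GRing.Lalgebra.on (freeAlg K X).

Definition gen (K : fieldType) (X : choiceType) (x : X) : freeAlg K X :=
  locked << fmu x >>.

Section FreeAlgebra.
Context (K : fieldType) (X : choiceType).

Lemma freeAlg_scalerAr (c : K) (f g : {malg K[{fmonom X}]}) :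
  c *: (f * g) = f * (c *: g).
Proof.
rewrite -[LHS]mul_malgC -[c *: g]mul_malgC [LHS]mulrA [RHS]mulrA.
apply: (congr1 (fun h => h * g)); rewrite [f]monalgE.
rewrite mulr_suml mulr_sumr; apply: eq_bigr => m _.
by rewrite !malgM_def !fgmulUU mul1m mulm1 mulrC.
Qed.

HB.instance Definition _ :=
  GRing.LSemiAlgebra_isSemiAlgebra.Build K (freeAlg K X) freeAlg_scalerAr.

Lemma malgZ_monom (c : K) (m : {fmonom X}) :
  << c *g m >> = c *: << m >> :> {malg K[{fmonom X}]}.
Proof. by rewrite -[RHS]mul_malgC malgM_def fgmulUU mulr1 mul1m. Qed.

Definition wordEval (B : algType K) (phi : X -> B) (m : {fmonom X}) : B :=
  \prod_(x <- (m : seq X)) phi x.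

Lemma wordEval_morph (B : algType K) (phi : X -> B) :
  mmorphism (wordEval phi).
Proof.
by split=> [m1 m2|]; rewrite /wordEval ?fm1 ?big_nil // fmM big_cat.
Qed.

HB.instance Definition _ (B : algType K) (phi : X -> B) :=
  isMultiplicative.Build {fmonom X} B (wordEval phi) (wordEval_morph phi).

Definition freeEval (B : algType K) (phi : X -> B) : freeAlg K X -> B :=
  mmap (in_alg B) (wordEval phi).

Section Eval.
Context (B : algType K) (phi : X -> B).

HB.instance Definition _ := GRing.Additive.copy (freeEval phi)
  (mmap (in_alg B : {rmorphism K -> B}) (wordEval phi)).

Lemma freeEval_mult : monoid_morphism (freeEval phi).
Proof.
have [H1 H2] : multiplicative (freeEval phi).
  apply: commr_mmap_is_multiplicative => g m m'.
  by rewrite /GRing.comm /= mulr_algl mulr_algr.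
by split.
Qed.

HB.instance Definition _ :=
  GRing.isMonoidMorphism.Build (freeAlg K X) B (freeEval phi) freeEval_mult.

Lemma freeEval_scal : scalable (freeEval phi).
Proof. by move=> c f; rewrite /freeEval mmapZ /= mulr_algl. Qed.

HB.instance Definition _ :=
  GRing.isScalable.Build K (freeAlg K X) B *:%R (freeEval phi) freeEval_scal.

Lemma freeEval_gen x : freeEval phi (gen K x) = phi x.
Proof.
by rewrite /freeEval /gen -lock mmapU /= scale1r mul1r /wordEval fmU big_seq1.
Qed.

Lemma freeEvalD f g : freeEval phi (f + g) = freeEval phi f + freeEval phi g.
Proof. exact: rmorphD. Qed.

Lemma freeEvalN f : freeEval phi (- f) = - freeEval phi f.
Proof. exact: rmorphN. Qed.

Lemma freeEvalM f g : freeEval phi (f * g) = freeEval phi f * freeEval phi g.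
Proof. exact: rmorphM. Qed.

Lemma freeEvalZ c f : freeEval phi (c *: f) = c *: freeEval phi f.
Proof. exact: linearZ. Qed.

Lemma freeEval1 : freeEval phi 1 = 1.
Proof. exact: rmorph1. Qed.

Definition freeEvalE :=
  (freeEval_gen, freeEval1, freeEvalD, freeEvalN, freeEvalZ, freeEvalM).

End Eval.
End FreeAlgebra.

(* Quotient of an algebra by the two-sided ideal generated by a set S.  As an
   [algType] is a non-trivial ring, properness of the ideal is an argument. *)
Inductive genIdeal (K : fieldType) (A : algType K) (S : A -> Prop) : A -> Prop :=
| genIdeal_in x : S x -> genIdeal S x
| genIdeal_0 : genIdeal S 0
| genIdeal_D x y : genIdeal S x -> genIdeal S y -> genIdeal S (x + y)
| genIdeal_Ml a x : genIdeal S x -> genIdeal S (a * x)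
| genIdeal_Mr a x : genIdeal S x -> genIdeal S (x * a).

Section Quotient.
Context (K : fieldType) (A : algType K) (S : A -> Prop).

Lemma genIdeal_Z (c : K) x : genIdeal S x -> genIdeal S (c *: x).
Proof. by move=> /(genIdeal_Ml c%:A); rewrite mulr_algl. Qed.

Lemma genIdeal_N x : genIdeal S x -> genIdeal S (- x).
Proof. by rewrite -scaleN1r; apply: genIdeal_Z. Qed.

Lemma genIdeal_kernel (B : algType K) (f : {lrmorphism A -> B}) :
  (forall x, S x -> f x = 0) -> forall x, genIdeal S x -> f x = 0.
Proof.
move=> fS x; elim=> {x} [x /fS //||x y _ fx _ fy|a x _ fx|a x _ fx].
- by rewrite rmorph0.
- by rewrite rmorphD /= fx fy addr0.
- by rewrite rmorphM /= fx mulr0.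
- by rewrite rmorphM /= fx mul0r.
Qed.

Definition quotRel : rel A := fun x y => `[< genIdeal S (x - y) >].

Lemma quotRel_refl : reflexive quotRel.
Proof. by move=> x; apply/asboolP; rewrite subrr; apply: genIdeal_0. Qed.

Lemma quotRel_sym : symmetric quotRel.
Proof.
by move=> x y; apply/asboolP/asboolP => /genIdeal_N; rewrite opprB.
Qed.

Lemma quotRel_trans : transitive quotRel.
Proof.
move=> y x z /asboolP xy /asboolP yz; apply/asboolP.
by have := genIdeal_D xy yz; rewrite addrA subrK.
Qed.

Canonical quotRel_equiv := EquivRel quotRel quotRel_refl quotRel_sym quotRel_trans.

Definition quotAlg (proper : ~ genIdeal S 1) := {eq_quot quotRel_equiv}.

Context (proper : ~ genIdeal S 1).
Local Notation Q := (quotAlg proper).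

HB.instance Definition _ := EqQuotient.on Q.
HB.instance Definition _ := Choice.on Q.

Definition quotProj (x : A) : Q := \pi_Q x.

Lemma quotProjP x y : quotProj x = quotProj y <-> genIdeal S (x - y).
Proof.
split; first by move=> /eqP; rewrite eqmodE => /asboolP.
by move=> h; apply/eqP; rewrite eqmodE; apply/asboolP.
Qed.

Lemma quotProj_surj (q : Q) : exists x, quotProj x = q.
Proof. by exists (repr q); apply: reprK. Qed.

Definition quotAdd (p q : Q) : Q := quotProj (repr p + repr q).
Definition quotOpp (p : Q) : Q := quotProj (- repr p).
Definition quotMul (p q : Q) : Q := quotProj (repr p * repr q).
Definition quotScale (c : K) (p : Q) : Q := quotProj (c *: repr p).

Lemma reprP x : genIdeal S (repr (quotProj x) - x).
Proof. by apply/quotProjP; apply: reprK. Qed.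

Lemma quotAddE x y : quotAdd (quotProj x) (quotProj y) = quotProj (x + y).
Proof.
apply/quotProjP; rewrite opprD addrACA.
by apply: genIdeal_D; apply: reprP.
Qed.

Lemma quotOppE x : quotOpp (quotProj x) = quotProj (- x).
Proof. by apply/quotProjP; rewrite -opprD; apply/genIdeal_N/reprP. Qed.

Lemma quotMulE x y : quotMul (quotProj x) (quotProj y) = quotProj (x * y).
Proof.
apply/quotProjP; set u := repr _; set v := repr _.
have -> : u * v - x * y = (u - x) * v + x * (v - y).
  by rewrite mulrBl mulrBr addrA subrK.
by apply: genIdeal_D; [apply: genIdeal_Mr | apply: genIdeal_Ml]; apply: reprP.
Qed.

Lemma quotScaleE c x : quotScale c (quotProj x) = quotProj (c *: x).
Proof. by apply/quotProjP; rewrite -scalerBr; apply/genIdeal_Z/reprP. Qed.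

Local Ltac qind := repeat (let q := fresh in move=> q; case: (quotProj_surj q) => ? <- {q}).

Lemma quotAddA : associative quotAdd.
Proof. by qind; rewrite !quotAddE addrA. Qed.
Lemma quotAddC : commutative quotAdd.
Proof. by qind; rewrite !quotAddE addrC. Qed.
Lemma quotAdd0 : left_id (quotProj 0) quotAdd.
Proof. by qind; rewrite !quotAddE add0r. Qed.
Lemma quotAddN : left_inverse (quotProj 0) quotOpp quotAdd.
Proof. by qind; rewrite quotOppE quotAddE addNr. Qed.

HB.instance Definition _ :=
  GRing.isZmodule.Build Q quotAddA quotAddC quotAdd0 quotAddN.

Lemma quotMulA : associative quotMul.
Proof. by qind; rewrite !quotMulE mulrA. Qed.
Lemma quotMul1l : left_id (quotProj 1) quotMul.
Proof. by qind; rewrite !quotMulE mul1r. Qed.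
Lemma quotMul1r : right_id (quotProj 1) quotMul.
Proof. by qind; rewrite !quotMulE mulr1. Qed.
Lemma quotMulDl : left_distributive quotMul quotAdd.
Proof. by qind; rewrite !(quotMulE, quotAddE) mulrDl. Qed.
Lemma quotMulDr : right_distributive quotMul quotAdd.
Proof. by qind; rewrite !(quotMulE, quotAddE) mulrDr. Qed.
Lemma quot1_neq0 : quotProj 1 != quotProj 0.
Proof. by apply/eqP => /quotProjP; rewrite subr0. Qed.

HB.instance Definition _ := GRing.Zmodule_isNzRing.Build Q
  quotMulA quotMul1l quotMul1r quotMulDl quotMulDr quot1_neq0.

Lemma quotScaleA a b (v : Q) : quotScale a (quotScale b v) = quotScale (a * b) v.
Proof. by case: (quotProj_surj v) => ? <-; rewrite !quotScaleE scalerA. Qed.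
Lemma quotScale1 : left_id 1 quotScale.
Proof. by qind; rewrite quotScaleE scale1r. Qed.
Lemma quotScaleDr : right_distributive quotScale +%R.
Proof.
move=> a; qind.
by rewrite /GRing.add /= !(quotScaleE, quotAddE) scalerDr.
Qed.
Lemma quotScaleDl (v : Q) : {morph quotScale^~ v : a b / a + b}.
Proof.
move=> a b; case: (quotProj_surj v) => x <-.
by rewrite /= /GRing.add /= !(quotScaleE, quotAddE) -scalerDl.
Qed.

HB.instance Definition _ := GRing.Zmodule_isLmodule.Build K Q
  quotScaleA quotScale1 quotScaleDr quotScaleDl.

Lemma quotScaleAl (a : K) (u v : Q) : a *: (u * v) = (a *: u) * v.
Proof.
case: (quotProj_surj u) (quotProj_surj v) => x <- [y <-].
by rewrite /GRing.scale /GRing.mul /= !(quotScaleE, quotMulE) scalerAl.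
Qed.
HB.instance Definition _ := GRing.LSemiModule_isLSemiAlgebra.Build K Q quotScaleAl.

Lemma quotScaleAr (a : K) (u v : Q) : a *: (u * v) = u * (a *: v).
Proof.
case: (quotProj_surj u) (quotProj_surj v) => x <- [y <-].
by rewrite /GRing.scale /GRing.mul /= !(quotScaleE, quotMulE) scalerAr.
Qed.
HB.instance Definition _ := GRing.LSemiAlgebra_isSemiAlgebra.Build K Q quotScaleAr.

Lemma quotProj_zmod : zmod_morphism quotProj.
Proof.
move=> x y; rewrite -quotAddE -quotOppE //.
Qed.
HB.instance Definition _ := GRing.isZmodMorphism.Build A Q quotProj quotProj_zmod.
Lemma quotProj_mult : monoid_morphism quotProj.
Proof. by split=> // x y; rewrite -quotMulE. Qed.
HB.instance Definition _ := GRing.isMonoidMorphism.Build A Q quotProj quotProj_mult.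
Lemma quotProj_scal : scalable quotProj.
Proof. by move=> c x; rewrite -quotScaleE. Qed.
HB.instance Definition _ := GRing.isScalable.Build K A Q *:%R quotProj quotProj_scal.

Lemma quot_lift (B : algType K) (f : {lrmorphism A -> B}) :
  (forall x, S x -> f x = 0) ->
  exists g : {lrmorphism Q -> B}, forall x, g (quotProj x) = f x.
Proof.
move=> fS; pose g (q : Q) : B := f (repr q).
have gE x : g (quotProj x) = f x.
  apply/eqP; rewrite -subr_eq0 -rmorphB; apply/eqP.
  by apply: genIdeal_kernel fS _ _; apply: reprP.
have gB : zmod_morphism g.
  by qind; rewrite -rmorphB !gE rmorphB.
have gM : monoid_morphism g.
  split; first by rewrite -(rmorph1 quotProj) gE rmorph1.
  by qind; rewrite -rmorphM !gE rmorphM.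
have gZ : scalable g.
  by move=> c; qind; rewrite -linearZ !gE linearZ.
pose m1 := GRing.isZmodMorphism.Build Q B g gB.
pose m2 := GRing.isMonoidMorphism.Build Q B g gM.
pose m3 := GRing.isScalable.Build K Q B *:%R g gZ.
pose h : {lrmorphism Q -> B} := HB.pack g m1 m2 m3.
by exists h => x; apply: gE.
Qed.

End Quotient.

Inductive ALgen := Om | Ep | Em | La.

HB.instance Definition _ := gen_eqMixin ALgen.
HB.instance Definition _ := gen_choiceMixin ALgen.

Inductive ALrel (K : fieldType) : freeAlg K ALgen -> Prop :=
| AL_central x : ALrel (gen K La * gen K x - gen K x * gen K La)
| AL_omega2 : ALrel (gen K Om ^+ 2 - 1)
| AL_omegaEp : ALrel (gen K Ep * gen K Om + gen K Om * gen K Ep)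
| AL_omegaEm : ALrel (gen K Em * gen K Om + gen K Om * gen K Em)
| AL_comm : ALrel (gen K Ep * gen K Em - gen K Em * gen K Ep
                   - (- (4%:R^-1)%:A + gen K La * gen K Om)).

(* Witness: the one-dimensional representation with omega_1 = 1,
   Lambda = 1/4 and E_+ = E_- = 0. *)
Lemma ALrel_proper (K : fieldType) : ~ genIdeal (@ALrel K) 1.
Proof.
pose phi (x : ALgen) : K^o :=
  match x with Om => 1 | Ep | Em => 0 | La => 4%:R^-1 end.
move=> /(genIdeal_kernel (f := freeEval phi)) H.
have /eqP : freeEval phi 1 = 0.
  have evM a b : freeEval phi (a * b) = freeEval phi a * freeEval phi b.
    exact: freeEvalM.
  have evDM a b c d : freeEval phi (a * b + c * d)
      = freeEval phi a * freeEval phi b + freeEval phi c * freeEval phi d.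
    exact: etrans (freeEvalD _ _ _) (congr2 +%R (evM _ _) (evM _ _)).
  have evBM a b c d : freeEval phi (a * b - c * d)
      = freeEval phi a * freeEval phi b - freeEval phi c * freeEval phi d.
    apply: (etrans (freeEvalD _ _ _) (congr2 +%R (evM _ _) _)).
    exact: etrans (freeEvalN _ _) (congr1 -%R (evM _ _)).
  apply: H => x [y||||] /=.
  - by rewrite evBM !freeEval_gen mulrC subrr.
  - by rewrite expr2 freeEvalD freeEvalN evM freeEval1 freeEval_gen mulr1 subrr.
  - by rewrite evDM !freeEval_gen mul0r mulr0 addr0.
  - by rewrite evDM !freeEval_gen mul0r mulr0 addr0.
  - rewrite freeEvalD evBM freeEvalN freeEvalD freeEvalN freeEvalZ evM freeEval1.
    rewrite !freeEval_gen /=.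
    by rewrite !mulr0 mulr1 /GRing.scale /= mulr1 addNr !subr0.
by rewrite freeEval1 oner_eq0.
Qed.

Definition AL (K : fieldType) : algType K := quotAlg (@ALrel_proper K).

(* Z/2-gradings; the degrees 0 and 1 are [false] and [true], so that addition
   of degrees is [addb] and their product is [andb]. *)
Record isGrading (K : fieldType) (V : lmodType K) (gr : bool -> V -> Prop) :
    Prop := IsGrading {
  gr_lin : forall p c u v, gr p u -> gr p v -> gr p (c *: u + v);
  gr_0 : forall p, gr p 0;
  gr_dec : forall v, exists v0, gr false v0 /\ gr true (v - v0);
  gr_disj : forall v, gr false v -> gr true v -> v = 0 }.

Section Grading.
Context (K : fieldType) (V : lmodType K) (gr : bool -> V -> Prop).
Context (G : isGrading gr).

Lemma gr_D p u v : gr p u -> gr p v -> gr p (u + v).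
Proof. by move=> gu; rewrite -[u]scale1r; apply: gr_lin. Qed.

Lemma gr_Z p c u : gr p u -> gr p (c *: u).
Proof. by move=> gu; rewrite -[_ *: _]addr0; apply: (gr_lin G) => //; apply: gr_0. Qed.

Lemma gr_N p u : gr p u -> gr p (- u).
Proof. by rewrite -scaleN1r; apply: gr_Z. Qed.

Lemma gr_B p u v : gr p u -> gr p v -> gr p (u - v).
Proof. by move=> gu gv; apply: gr_D => //; apply: gr_N. Qed.

Definition evenPart (v : V) : V := projT1 (cid (gr_dec G v)).
Definition oddPart (v : V) : V := v - evenPart v.

(* v = v_0 + v_1 |-> v_0 - v_1 *)
Definition parityMap (v : V) : V := locked (evenPart v - oddPart v).

Lemma evenPart_gr v : gr false (evenPart v).
Proof. by rewrite /evenPart; case: cid => x []. Qed.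

Lemma oddPart_gr v : gr true (oddPart v).
Proof. by rewrite /oddPart /evenPart; case: cid => x []. Qed.

Lemma evenOddPart v : evenPart v + oddPart v = v.
Proof. by rewrite addrC subrK. Qed.

Lemma gr_split v : exists v0 v1, [/\ gr false v0, gr true v1 & v = v0 + v1].
Proof.
exists (evenPart v), (oddPart v); rewrite evenOddPart.
by split=> //; [apply: evenPart_gr | apply: oddPart_gr].
Qed.

Lemma evenPart_uniq v v0 v1 :
  gr false v0 -> gr true v1 -> v = v0 + v1 -> evenPart v = v0.
Proof.
move=> g0 g1 ->; apply/eqP; rewrite -subr_eq0; apply/eqP.
apply: (gr_disj G); first exact: gr_B (evenPart_gr _) g0.
have -> : evenPart (v0 + v1) - v0 = v1 - oddPart (v0 + v1).
  rewrite /oddPart; move: (evenPart _) => e.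
  by rewrite opprB addrCA opprD [v1 + _]addrCA subrr addr0.
exact: gr_B g1 (oddPart_gr _).
Qed.

Lemma parityMap_homog p v : gr p v -> parityMap v = (-1) ^+ p *: v.
Proof.
case: p => gv; rewrite /parityMap -!lock /oddPart.
  by rewrite (@evenPart_uniq v 0 v) ?add0r ?subr0 ?scaleN1r //; apply: gr_0.
rewrite (@evenPart_uniq v v 0) ?addr0 ?subrr ?subr0 ?scale1r //.
exact: gr_0.
Qed.

Lemma evenPart_lin : linear evenPart.
Proof.
move=> c u v; apply: (@evenPart_uniq _ _ (c *: oddPart u + oddPart v)).
- by apply: (gr_lin G); apply: evenPart_gr.
- by apply: (gr_lin G); apply: oddPart_gr.
- by rewrite addrACA -scalerDr !evenOddPart.
Qed.

Lemma parityMap_lin : linear parityMap.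
Proof.
move=> c u v; rewrite /parityMap -!lock /oddPart evenPart_lin !opprB.
move: (evenPart u) (evenPart v) => a b.
have -> : c *: a + b - (c *: u + v) = c *: (a - u) + (b - v).
  by rewrite scalerBr opprD addrACA.
by rewrite addrACA -scalerDr.
Qed.

End Grading.

Structure superAlgebra (K : fieldType) := SuperAlgebra {
  sa_car :> algType K;
  sa_gr : bool -> sa_car -> Prop;
  sa_grading : isGrading sa_gr;
  sa_gr1 : sa_gr false 1;
  sa_grM : forall p q a b, sa_gr p a -> sa_gr q b -> sa_gr (p (+) q) (a * b) }.

(* [Smash a b] stands for a + b P in the smash product of A by the group
   {1, P}; the product is the one forced by P ^ 2 = 1 and P a = a^s P with s
   the parity map (a^s = (-1)^(deg a) a for a homogeneous). *)
Record smash (K : fieldType) (A : superAlgebra K) := Smash { smash0 : A; smash1 : A }.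

Section Smash.
Context (K : fieldType) (A : superAlgebra K).

Definition smash_pair (x : smash A) : A * A := (smash0 x, smash1 x).
Definition pair_smash (x : A * A) : smash A := Smash x.1 x.2.
Lemma smash_pairK : cancel smash_pair pair_smash.
Proof. by case. Qed.

HB.instance Definition _ := Choice.copy (smash A) (can_type smash_pairK).

Definition smashAdd (x y : smash A) : smash A :=
  Smash (smash0 x + smash0 y) (smash1 x + smash1 y).
Definition smashOpp (x : smash A) : smash A := Smash (- smash0 x) (- smash1 x).
Definition smashScale (k : K) (x : smash A) : smash A :=
  Smash (k *: smash0 x) (k *: smash1 x).

Lemma smashAddA : associative smashAdd.
Proof. by move=> x y z; congr Smash; rewrite /= addrA. Qed.
Lemma smashAddC : commutative smashAdd.
Proof. by move=> x y; congr Smash; rewrite /= addrC. Qed.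
Lemma smashAdd0 : left_id (Smash 0 0) smashAdd.
Proof. by case=> a b; congr Smash; rewrite /= add0r. Qed.
Lemma smashAddN : left_inverse (Smash 0 0) smashOpp smashAdd.
Proof. by move=> x; congr Smash; rewrite /= addNr. Qed.

HB.instance Definition _ :=
  GRing.isZmodule.Build (smash A) smashAddA smashAddC smashAdd0 smashAddN.

Lemma smashScaleA a b (v : smash A) :
  smashScale a (smashScale b v) = smashScale (a * b) v.
Proof. by congr Smash; rewrite /= scalerA. Qed.
Lemma smashScale1 : left_id 1 smashScale.
Proof. by case=> a b; congr Smash; rewrite /= scale1r. Qed.
Lemma smashScaleDr : right_distributive smashScale +%R.
Proof. by move=> a x y; congr Smash; rewrite /= scalerDr. Qed.
Lemma smashScaleDl (v : smash A) : {morph smashScale^~ v : a b / a + b}.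
Proof. by move=> a b; congr Smash; rewrite /= scalerDl. Qed.

HB.instance Definition _ := GRing.Zmodule_isLmodule.Build K (smash A)
  smashScaleA smashScale1 smashScaleDr smashScaleDl.

Local Notation sg := (parityMap (sa_grading A)).

Lemma parity_add (a b : A) : sg (a + b) = sg a + sg b.
Proof. by have := parityMap_lin (sa_grading A) 1 a b; rewrite !scale1r. Qed.

Lemma parity_scale (c : K) (a : A) : sg (c *: a) = c *: sg a.
Proof.
have h := parityMap_lin (sa_grading A).
have h0 : sg 0 = 0.
  by rewrite (parityMap_homog (sa_grading A) (gr_0 (sa_grading A) false)) scaler0.
by have := h c a 0; rewrite !addr0 h0 addr0.
Qed.

Lemma parity_0 : sg 0 = 0.
Proof. by rewrite -(scale0r 0) parity_scale !scale0r. Qed.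

Lemma parity_1 : sg 1 = 1.
Proof. by rewrite (parityMap_homog _ (sa_gr1 A)) scale1r. Qed.

Lemma parity_mul (a b : A) : sg (a * b) = sg a * sg b.
Proof.
have G := sa_grading A.
have hom p q x y : sa_gr p x -> sa_gr q y -> sg (x * y) = sg x * sg y.
  move=> hx hy; rewrite (parityMap_homog _ (sa_grM hx hy)).
  rewrite (parityMap_homog _ hx) (parityMap_homog _ hy).
  by rewrite -scalerAl -scalerAr scalerA signr_addb.
have [a0 [a1 [ea oa ->]]] := gr_split G a.
have [b0 [b1 [eb ob ->]]] := gr_split G b.
have E (x y z t : A) : (x + y) * (z + t) = x * z + x * t + (y * z + y * t).
  by rewrite mulrDl !mulrDr.
rewrite [in LHS]E !parity_add (hom _ _ _ _ ea eb) (hom _ _ _ _ ea ob).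
by rewrite (hom _ _ _ _ oa eb) (hom _ _ _ _ oa ob) -E.
Qed.

Lemma parity_inv (a : A) : sg (sg a) = a.
Proof.
have [a0 [a1 [ea oa ->]]] := gr_split (sa_grading A) a.
rewrite !parity_add (parityMap_homog _ ea) (parityMap_homog _ oa) !parity_scale.
rewrite (parityMap_homog _ ea) (parityMap_homog _ oa) !scalerA.
by rewrite !expr0 !expr1 mulrNN !mulr1 !scale1r.
Qed.

Definition smashOne : smash A := Smash 1 0.
Definition smashMul (x y : smash A) : smash A :=
  Smash (smash0 x * smash0 y + smash1 x * sg (smash1 y))
        (smash0 x * smash1 y + smash1 x * sg (smash0 y)).

Lemma smashMulA : associative smashMul.
Proof.
move=> [a b] [c d] [e f]; rewrite /smashMul /=; congr Smash;
  rewrite !(mulrDl, mulrDr, parity_add, parity_mul, parity_inv) !mulrA -!addrA;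
  congr (_ + _); rewrite [RHS]addrC -!addrA; congr (_ + _);
  by rewrite addrC.
Qed.

Lemma smashMul1l : left_id smashOne smashMul.
Proof. by case=> a b; rewrite /smashMul /= !mul1r !mul0r !addr0. Qed.

Lemma smashMul1r : right_id smashOne smashMul.
Proof.
case=> a b; rewrite /smashMul /= parity_1 !mulr1 !mulr0 add0r.
by rewrite parity_0 mulr0 addr0.
Qed.

Lemma smashMulDl : left_distributive smashMul +%R.
Proof.
move=> [a b] [c d] [e f]; rewrite /smashMul /=; congr Smash;
  by rewrite !mulrDl addrACA.
Qed.

Lemma smashMulDr : right_distributive smashMul +%R.
Proof.
move=> [a b] [c d] [e f]; rewrite /smashMul /=; congr Smash;
  by rewrite !parity_add !mulrDr addrACA.
Qed.

Lemma smash1_neq0 : smashOne != 0.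
Proof. by apply/eqP => - [] /eqP; rewrite oner_eq0. Qed.

HB.instance Definition _ := GRing.Zmodule_isNzRing.Build (smash A)
  smashMulA smashMul1l smashMul1r smashMulDl smashMulDr smash1_neq0.

Lemma smash_scalerAl (k : K) (x y : smash A) : k *: (x * y) = (k *: x) * y.
Proof.
case: x y => a b [c d]; congr Smash; by rewrite /= scalerDr !scalerAl.
Qed.

HB.instance Definition _ :=
  GRing.LSemiModule_isLSemiAlgebra.Build K (smash A) smash_scalerAl.

Lemma smash_scalerAr (k : K) (x y : smash A) : k *: (x * y) = x * (k *: y).
Proof.
case: x y => a b [c d]; congr Smash;
  by rewrite /= parity_scale scalerDr !scalerAr.
Qed.

HB.instance Definition _ :=
  GRing.LSemiAlgebra_isSemiAlgebra.Build K (smash A) smash_scalerAr.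

Definition smashIn (a : A) : smash A := Smash a 0.
Definition smashP : smash A := Smash 0 1.

Lemma smashIn_zmod : zmod_morphism smashIn.
Proof. by move=> a b; congr Smash; rewrite /= subrr. Qed.

Lemma smashIn_mult : monoid_morphism smashIn.
Proof. by split=> // a b; congr Smash; rewrite /= ?mul0r ?mulr0 addr0. Qed.

Lemma smashIn_scal : scalable smashIn.
Proof. by move=> k a; congr Smash; rewrite /= scaler0. Qed.

HB.instance Definition _ :=
  GRing.isZmodMorphism.Build A (smash A) smashIn smashIn_zmod.
HB.instance Definition _ :=
  GRing.isMonoidMorphism.Build A (smash A) smashIn smashIn_mult.
HB.instance Definition _ :=
  GRing.isScalable.Build K A (smash A) *:%R smashIn smashIn_scal.

Lemma smashP2 : smashP ^+ 2 = 1.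
Proof.
rewrite expr2; congr Smash; rewrite /= ?parity_1 ?parity_0.
  by rewrite mulr0 mulr1 add0r.
by rewrite mul0r mulr0 addr0.
Qed.

Lemma smashP_comm p (a : A) : sa_gr p a ->
  smashP * smashIn a = (-1) ^+ p *: (smashIn a * smashP).
Proof.
move=> ga; congr Smash; rewrite /= ?parity_1 ?parity_0 ?(parityMap_homog _ ga).
  by rewrite !(mulr0, mul0r, addr0) scaler0.
by rewrite !(mulr0, mul0r) mul1r mulr1 add0r addr0.
Qed.

Lemma smash_dec (x : smash A) :
  x = smashIn (smash0 x) + smashIn (smash1 x) * smashP.
Proof.
case: x => a b; congr Smash; rewrite /= ?parity_1 ?parity_0.
  by rewrite mulr0 mul0r !addr0.
by rewrite mulr0 mulr1 addr0 add0r.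
Qed.

End Smash.

Structure lieSuperalgebra (K : fieldType) := LieSuperalgebra {
  ls_car :> lmodType K;
  ls_gr : bool -> ls_car -> Prop;
  ls_br : ls_car -> ls_car -> ls_car;
  ls_grading : isGrading ls_gr;
  ls_linl : forall c x y z, ls_br (c *: x + y) z = c *: ls_br x z + ls_br y z;
  ls_linr : forall c x y z, ls_br x (c *: y + z) = c *: ls_br x y + ls_br x z;
  ls_grbr : forall p q x y,
    ls_gr p x -> ls_gr q y -> ls_gr (p (+) q) (ls_br x y);
  ls_anti : forall p q x y, ls_gr p x -> ls_gr q y ->
    ls_br x y = - ((-1) ^+ (p && q) *: ls_br y x);
  ls_jacobi : forall p q x y z, ls_gr p x -> ls_gr q y ->
    ls_br x (ls_br y z)
      = ls_br (ls_br x y) z + (-1) ^+ (p && q) *: ls_br y (ls_br x z) }.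

Inductive envRel (K : fieldType) (g : lieSuperalgebra K) :
    freeAlg K g -> Prop :=
| env_lin c (x y : g) :
    envRel (gen K (c *: x + y) - (c *: gen K x + gen K y))
| env_br p q (x y : g) : ls_gr p x -> ls_gr q y ->
    envRel (gen K x * gen K y - (-1) ^+ (p && q) *: (gen K y * gen K x)
            - gen K (ls_br x y)).

Lemma envRel_proper (K : fieldType) (g : lieSuperalgebra K) :
  ~ genIdeal (@envRel K g) 1.
Proof.
pose phi (x : g) : K^o := 0.
move=> /(genIdeal_kernel (f := freeEval phi)) H.
have /eqP : freeEval phi 1 = 0.
  apply: H => x [c y z|p q y z _ _] /=; rewrite !freeEvalE /phi.
    by rewrite scaler0 addr0 subrr.
  by rewrite mulr0 scaler0 !subr0.
by rewrite freeEval1 oner_eq0.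
Qed.

Definition envAlg (K : fieldType) (g : lieSuperalgebra K) : algType K :=
  quotAlg (@envRel_proper K g).

Definition envIn (K : fieldType) (g : lieSuperalgebra K) (x : g) : envAlg g :=
  quotProj (@envRel_proper K g) (gen K x).

(* For an algebra U with a map i : g -> U: the degree p part of U is spanned by
   the products of images of homogeneous elements of g whose degrees add up
   to p. *)
Inductive spanGr (K : fieldType) (g : lieSuperalgebra K) (U : algType K)
    (i : g -> U) : bool -> U -> Prop :=
| spanGr_0 p : spanGr i p 0
| spanGr_1 : spanGr i false 1
| spanGr_lin p c u v :
    spanGr i p u -> spanGr i p v -> spanGr i p (c *: u + v)
| spanGr_M p q (x : g) u :
    ls_gr p x -> spanGr i q u -> spanGr i (p (+) q) (i x * u).

Section SpanGrading.
Context (K : numFieldType) (g : lieSuperalgebra K) (U : algType K) (i : g -> U).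
Implicit Types (x y : g) (u v : U).

Lemma spanGr_D p u v : spanGr i p u -> spanGr i p v -> spanGr i p (u + v).
Proof. by move=> gu gv; rewrite -[u]scale1r; apply: spanGr_lin. Qed.

Lemma spanGr_Z p c u : spanGr i p u -> spanGr i p (c *: u).
Proof.
by move=> gu; rewrite -[_ *: _]addr0; apply: spanGr_lin => //; apply: spanGr_0.
Qed.

Lemma spanGr_mul p q u v :
  spanGr i p u -> spanGr i q v -> spanGr i (p (+) q) (u * v).
Proof.
move=> gu gv; elim: gu => {p u} [p||p c u1 u2 _ h1 _ h2|p r x u gx _ h].
- by rewrite mul0r; apply: spanGr_0.
- by rewrite mul1r.
- by rewrite mulrDl -scalerAl; apply: spanGr_lin.
- by rewrite -mulrA -addbA; apply: spanGr_M.
Qed.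

Hypothesis i_lin : forall c x y, i (c *: x + y) = c *: i x + i y.
Hypothesis i_ind : forall D : U -> Prop, D 1 ->
  (forall c u v, D u -> D v -> D (c *: u + v)) ->
  (forall x u, D u -> D (i x * u)) -> forall u, D u.

Lemma iD x y : i (x + y) = i x + i y.
Proof. by have := i_lin 1 x y; rewrite !scale1r. Qed.

Lemma i0 : i 0 = 0.
Proof. by apply: (addrI (i 0)); rewrite -iD !addr0. Qed.

Lemma iZ c x : i (c *: x) = c *: i x.
Proof. by have := i_lin c x 0; rewrite !addr0 i0 addr0. Qed.

Lemma spanGr_dec u : exists u0, spanGr i false u0 /\ spanGr i true (u - u0).
Proof.
pose D (u : U) :=
  exists u0 u1, [/\ spanGr i false u0, spanGr i true u1 & u = u0 + u1].
suff [u0 [u1 [h0 h1 ->]]] : D u by exists u0; rewrite addrC addKr.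
elim/i_ind: u => [|c a b|x a].
- by exists 1, 0; rewrite addr0; split=> //; [apply: spanGr_1 | apply: spanGr_0].
- move=> [a0 [a1 [ha0 ha1 ->]]] [b0 [b1 [hb0 hb1 ->]]].
  exists (c *: a0 + b0), (c *: a1 + b1); rewrite scalerDr addrACA.
  by split=> //; apply: spanGr_lin.
- move=> [a0 [a1 [ha0 ha1 ->]]].
  have [x0 [x1 [hx0 hx1 ->]]] := gr_split (ls_grading g) x.
  exists (i x0 * a0 + i x1 * a1), (i x0 * a1 + i x1 * a0).
  split.
  - by apply: spanGr_D; [apply: (spanGr_M hx0 ha0) | apply: (spanGr_M hx1 ha1)].
  - by apply: spanGr_D; [apply: (spanGr_M hx0 ha1) | apply: (spanGr_M hx1 ha0)].
  - rewrite iD mulrDl !mulrDr -!addrA; congr (_ + _).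
    by rewrite [LHS]addrC -addrA addrC -addrA; congr (_ + _); rewrite addrC.
Qed.

Lemma spanGr_disj (s : {lrmorphism U -> U}) :
  (forall x, s (i x) = i (parityMap (ls_grading g) x)) ->
  forall u, spanGr i false u -> spanGr i true u -> u = 0.
Proof.
move=> sE.
have sgr p v : spanGr i p v -> s v = (-1) ^+ p *: v.
  elim=> {p v} [p||p c v w _ hv _ hw|p q x v gx _ hv].
  - by rewrite rmorph0 scaler0.
  - by rewrite rmorph1 scale1r.
  - by rewrite linearP /= hv hw scalerDr !scalerA mulrC.
  - rewrite rmorphM /= sE hv (parityMap_homog _ gx) iZ.
    by rewrite -scalerAl -scalerAr scalerA signr_addb.
move=> u /sgr; rewrite scale1r => e0 /sgr; rewrite e0 scaleN1r => /eqP.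
rewrite -subr_eq0 opprK -mulr2n -scaler_nat scaler_eq0.
by rewrite pnatr_eq0 /= => /eqP.
Qed.

Lemma parity_br :
  (forall p q x y, ls_gr p x -> ls_gr q y ->
     i x * i y - (-1) ^+ (p && q) *: (i y * i x) = i (ls_br x y)) ->
  let j x := i (parityMap (ls_grading g) x) in
  (forall p q x y, ls_gr p x -> ls_gr q y ->
     j x * j y - (-1) ^+ (p && q) *: (j y * j x) = j (ls_br x y)).
Proof.
move=> i_br j p q x y gx gy; rewrite /j.
rewrite (parityMap_homog _ gx) (parityMap_homog _ gy).
rewrite (parityMap_homog _ (ls_grbr gx gy)) !iZ -(i_br _ _ _ _ gx gy).
rewrite -!scalerAl -!scalerAr !scalerA scalerBr scalerA signr_addb.
by congr (_ - _ *: _); rewrite mulrC -mulrA [X in _ = _ * X]mulrC; case: p q {gx gy} => -[]; rewrite /= ?(mulr1, mul1r, mulrN, mulNr).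
Qed.

End SpanGrading.

Section Enveloping.
Context (K : numFieldType) (g : lieSuperalgebra K).
Local Notation U := (envAlg g).
Local Notation proj := (quotProj (@envRel_proper K g)).
Implicit Types (x y : g) (u v : U).

Lemma envIn_lin c x y : envIn (c *: x + y) = c *: envIn x + envIn y.
Proof.
have := quotProjP (@envRel_proper K g) (gen K (c *: x + y)) (c *: gen K x + gen K y).
move=> [_ /(_ (genIdeal_in (env_lin c x y)))] h.
by apply: (etrans h); exact: linearP.
Qed.

Lemma envIn_br p q x y : ls_gr p x -> ls_gr q y ->
  envIn x * envIn y - (-1) ^+ (p && q) *: (envIn y * envIn x)
    = envIn (ls_br x y).
Proof.
move=> gx gy.
have [_ /(_ (genIdeal_in (env_br gx gy))) h] := quotProjP (@envRel_proper K g)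
  (gen K x * gen K y - (-1) ^+ (p && q) *: (gen K y * gen K x)) (gen K (ls_br x y)).
apply: (etrans _ h); apply: esym; apply: (etrans (rmorphB proj _ _)).
have e1 : proj (gen K x * gen K y) = envIn x * envIn y by exact: (rmorphM proj).
have e2 : proj (gen K y * gen K x) = envIn y * envIn x by exact: (rmorphM proj).
have e3 c w : proj (c *: w) = c *: (proj w : U) by exact: quotProj_scal.
exact: (congr2 (fun a b : U => a - b) e1 (etrans (e3 _ _) (congr1 _ e2))).
Qed.

Lemma env_lift (B : algType K) (phi : g -> B) :
  (forall c x y, phi (c *: x + y) = c *: phi x + phi y) ->
  (forall p q x y, ls_gr p x -> ls_gr q y ->
     phi x * phi y - (-1) ^+ (p && q) *: (phi y * phi x) = phi (ls_br x y)) ->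
  exists f : {lrmorphism U -> B}, forall x, f (envIn x) = phi x.
Proof.
move=> philin phibr.
have [|f fE] := @quot_lift _ _ _ (@envRel_proper K g) B (freeEval phi).
  move=> w [c x y|p q x y gx gy] /=; rewrite !freeEvalE.
    by rewrite philin subrr.
  by rewrite (phibr _ _ _ _ gx gy) subrr.
by exists f => x; apply: (etrans (fE _)); exact: freeEval_gen.
Qed.

Lemma env_ind (D : U -> Prop) : D 1 ->
  (forall c u v, D u -> D v -> D (c *: u + v)) ->
  (forall x u, D u -> D (envIn x * u)) -> forall u, D u.
Proof.
move=> D1 DL DM u; have [f <-] := quotProj_surj u.
have D0 : D (proj 0).
  have := DL (-1) _ _ D1 D1; congr D.
  by rewrite scaleN1r addNr; apply: esym; exact: (rmorph0 proj).
rewrite [f]monalgE; elim/big_rec: _ => // m a _ Da.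
have -> : << f@_m *g m >> + a = f@_m *: << m >> + a :> freeAlg K g.
  by rewrite malgZ_monom.
rewrite -[X in D X]/(proj _).
have -> : proj (f@_m *: << m >> + a) = f@_m *: proj << m >> + proj a.
  exact: (linearP proj).
apply: DL; last exact: Da.
case: m => s; elim: s => [|x s IHs].
  by move: D1; congr D; apply: esym; rewrite -fmoneE; exact: (rmorph1 proj).
have -> : << FMonom (x :: s) >> = gen K x * << FMonom s >> :> freeAlg K g.
  by rewrite /gen -lock malgM_def fgmulUU mulr1 /mmul /= fmmulE fmuE.
have -> : proj (gen K x * << FMonom s >>) = envIn x * proj << FMonom s >>.
  exact: (rmorphM proj).
exact: DM.
Qed.

Lemma env_grading : isGrading (spanGr (@envIn K g)).
Proof.
split; [exact: spanGr_lin | exact: spanGr_0 | |].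
  exact: (spanGr_dec envIn_lin env_ind).
have [||s sE] := @env_lift U (fun x => envIn (parityMap (ls_grading g) x)).
- by move=> c x y; rewrite parityMap_lin envIn_lin.
- exact: (parity_br envIn_lin envIn_br).
exact: (spanGr_disj envIn_lin sE).
Qed.

Definition envSuperalgebra : superAlgebra K :=
  SuperAlgebra env_grading (spanGr_1 _) (@spanGr_mul _ _ _ _).

End Enveloping.

(* The superspace K^(m|2n): column vectors indexed by 'I_(m + (n + n)), the
   first m coordinates being even and the last 2n odd. *)
Section Gl.
Context (K : numFieldType) (m n : nat).
Local Notation N := (m + (n + n))%N.
Implicit Types (X Y Z : 'M[K]_N) (v w : 'cV[K]_N).

Definition idxPar (i : 'I_N) : bool := (m <= i)%N.

Definition vecGr (p : bool) v : Prop := forall i, idxPar i != p -> v i 0 = 0.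

Definition glGr (p : bool) X : Prop :=
  forall i j, idxPar i (+) idxPar j != p -> X i j = 0.

Definition glComp (p : bool) X : 'M[K]_N :=
  \matrix_(i, j) (if idxPar i (+) idxPar j == p then X i j else 0).

Definition superComm X Y : 'M[K]_N :=
  \sum_(p : bool) \sum_(q : bool)
    (glComp p X *m glComp q Y - (-1) ^+ (p && q) *: (glComp q Y *m glComp p X)).

(* Even supersymmetric non-degenerate form: symmetric on the even part,
   symplectic on the odd part. *)
Definition ospFormMx : 'M[K]_N :=
  block_mx 1%:M 0 0 (block_mx 0 1%:M (- 1%:M) 0).

Definition ospForm v w : K := (v^T *m ospFormMx *m w) 0 0.

Definition ospHom (p : bool) X : Prop :=
  glGr p X /\ forall r v w, vecGr r v ->
    ospForm (X *m v) w + (-1) ^+ (p && r) * ospForm v (X *m w) = 0.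

Definition osp_pred : {pred 'M[K]_N} :=
  fun X => `[< forall p, ospHom p (glComp p X) >].

Lemma glComp_lin p : linear (glComp p).
Proof.
move=> c X Y; apply/matrixP => i j; rewrite !mxE.
by case: ifP => // _; rewrite mulr0 addr0.
Qed.

Lemma glComp_gr p X : glGr p (glComp p X).
Proof. by move=> i j; rewrite mxE => /negbTE ->. Qed.

Lemma glComp_sum X : X = glComp false X + glComp true X.
Proof.
by apply/matrixP => i j; rewrite !mxE; case: (_ (+) _); rewrite ?addr0 ?add0r.
Qed.

Lemma glComp_id p X : glGr p X -> glComp p X = X.
Proof.
move=> gX; apply/matrixP => i j; rewrite mxE; case: ifPn => // h.
by rewrite gX.
Qed.

Lemma glComp_other p q X : glGr p X -> q != p -> glComp q X = 0.
Proof.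
move=> gX qp; apply/matrixP => i j; rewrite !mxE; case: eqP => // h.
by rewrite gX // h.
Qed.

Lemma glGr_lin p c X Y : glGr p X -> glGr p Y -> glGr p (c *: X + Y).
Proof. by move=> gX gY i j h; rewrite !mxE gX // gY // mulr0 addr0. Qed.

Lemma glGr_0 p : glGr p 0.
Proof. by move=> i j _; rewrite mxE. Qed.

Lemma glGr_mul p q X Y : glGr p X -> glGr q Y -> glGr (p (+) q) (X *m Y).
Proof.
move=> gX gY i j h; rewrite mxE big1 // => k _.
have [e|ne] := eqVneq (idxPar i (+) idxPar k) p; last by rewrite gX ?mul0r.
rewrite gY ?mulr0 //; apply: contra h => /eqP <-; rewrite -e.
by case: (idxPar i) (idxPar k) (idxPar j) => [] [] [].
Qed.

Lemma superComm_hom p q X Y : glGr p X -> glGr q Y ->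
  superComm X Y = X *m Y - (-1) ^+ (p && q) *: (Y *m X).
Proof.
move=> gX gY; rewrite /superComm (bigD1 p) //= [X in _ + X]big1 ?addr0.
  rewrite (bigD1 q) //= big1 ?addr0 => [|r rq].
    by rewrite !glComp_id.
  by rewrite (glComp_other gY rq) mulmx0 mul0mx scaler0 subrr.
move=> r rp; rewrite big1 // => s _.
by rewrite (glComp_other gX rp) mulmx0 mul0mx scaler0 subrr.
Qed.

Lemma superComm_linl c X Y Z :
  superComm (c *: X + Y) Z = c *: superComm X Z + superComm Y Z.
Proof.
rewrite /superComm scaler_sumr -big_split; apply: eq_bigr => p _ /=.
rewrite scaler_sumr -big_split; apply: eq_bigr => q _ /=.
rewrite glComp_lin mulmxDl mulmxDr -scalemxAl -scalemxAr scalerDr scalerBr.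
by rewrite !scalerA [_ * c]mulrC opprD addrACA.
Qed.

Lemma superComm_linr c X Y Z :
  superComm X (c *: Y + Z) = c *: superComm X Y + superComm X Z.
Proof.
rewrite /superComm scaler_sumr -big_split; apply: eq_bigr => p _ /=.
rewrite scaler_sumr -big_split; apply: eq_bigr => q _ /=.
rewrite glComp_lin mulmxDl mulmxDr -scalemxAl -scalemxAr scalerDr scalerBr.
by rewrite !scalerA [_ * c]mulrC opprD addrACA.
Qed.

Lemma superComm_gr p q X Y :
  glGr p X -> glGr q Y -> glGr (p (+) q) (superComm X Y).
Proof.
move=> gX gY; rewrite (superComm_hom gX gY) addrC -scaleNr.
by apply: glGr_lin; [rewrite addbC|]; apply: glGr_mul.
Qed.

Lemma superComm_anti p q X Y : glGr p X -> glGr q Y ->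
  superComm X Y = - ((-1) ^+ (p && q) *: superComm Y X).
Proof.
move=> gX gY; rewrite (superComm_hom gX gY) (superComm_hom gY gX).
by rewrite andbC scalerBr scalerA -signr_addb addbb scale1r opprB.
Qed.

Lemma superComm_D X Y Z : superComm X (Y + Z) = superComm X Y + superComm X Z.
Proof. by have := superComm_linr 1 X Y Z; rewrite !scale1r. Qed.

Lemma superComm_Dl X Y Z : superComm (X + Y) Z = superComm X Z + superComm Y Z.
Proof. by have := superComm_linl 1 X Y Z; rewrite !scale1r. Qed.

Lemma superComm_jacobi p q X Y Z : glGr p X -> glGr q Y ->
  superComm X (superComm Y Z)
    = superComm (superComm X Y) Z
      + (-1) ^+ (p && q) *: superComm Y (superComm X Z).
Proof.
move=> gX gY.
suff H r W : glGr r W -> superComm X (superComm Y W)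
    = superComm (superComm X Y) W
      + (-1) ^+ (p && q) *: superComm Y (superComm X W).
  rewrite (glComp_sum Z) !superComm_D.
  rewrite (H _ _ (@glComp_gr false Z)) (H _ _ (@glComp_gr true Z)).
  by rewrite scalerDr addrACA.
move=> gW.
rewrite (superComm_hom gX (superComm_gr gY gW)).
rewrite (superComm_hom gY (superComm_gr gX gW)).
rewrite (superComm_hom (superComm_gr gX gY) gW).
rewrite (superComm_hom gX gY) (superComm_hom gX gW) (superComm_hom gY gW).
rewrite !(mulmxBl, mulmxBr) -!scalemxAl -!scalemxAr !mulmxA.
move: (X *m Y *m W) (X *m W *m Y) (Y *m X *m W) (Y *m W *m X) (W *m X *m Y)
  (W *m Y *m X) => a b c d e f.
by apply/matrixP => i j; rewrite !mxE; case: p q r {gX gY gW} => [] [] []; ring.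
Qed.

Lemma ospForm_linl c v v' w :
  ospForm (c *: v + v') w = c * ospForm v w + ospForm v' w.
Proof. by rewrite /ospForm linearP /= !mulmxDl -!scalemxAl !mxE. Qed.

Lemma ospForm_linr c v w w' :
  ospForm v (c *: w + w') = c * ospForm v w + ospForm v w'.
Proof. by rewrite /ospForm mulmxDr -scalemxAr !mxE. Qed.

Lemma ospForm_0l w : ospForm 0 w = 0.
Proof. by rewrite /ospForm trmx0 !mul0mx mxE. Qed.

Lemma ospForm_0r v : ospForm v 0 = 0.
Proof. by rewrite /ospForm mulmx0 mxE. Qed.

Lemma ospHom_lin p c X Y : ospHom p X -> ospHom p Y -> ospHom p (c *: X + Y).
Proof.
move=> [gX hX] [gY hY]; split; first exact: glGr_lin.
move=> r v w gv; rewrite !mulmxDl -!scalemxAl ospForm_linl ospForm_linr.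
have /eqP := hX _ _ w gv; rewrite addr_eq0 => /eqP ->.
have /eqP := hY _ _ w gv; rewrite addr_eq0 => /eqP ->.
ring.
Qed.

Lemma ospHom_0 p : ospHom p 0.
Proof.
split=> [|r v w _]; first exact: glGr_0.
by rewrite !mul0mx ospForm_0l ospForm_0r mulr0 addr0.
Qed.

Lemma ospHom_in p X : ospHom p X -> X \in osp_pred.
Proof.
move=> hX; apply/asboolP => q; have [->|qp] := eqVneq q p.
  by rewrite (glComp_id hX.1).
by rewrite (glComp_other hX.1 qp); apply: ospHom_0.
Qed.

Lemma vecGr_mul p r X v : glGr p X -> vecGr r v -> vecGr (p (+) r) (X *m v).
Proof.
move=> gX gv i h; rewrite mxE big1 // => j _.
have [e|ne] := eqVneq (idxPar j) r; last by rewrite gv ?mulr0.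
rewrite gX ?mul0r //; apply: contra h => /eqP <-; rewrite -e.
by case: (idxPar i) (idxPar j) => [] [].
Qed.

Lemma ospHom_comm p q X Y :
  ospHom p X -> ospHom q Y -> ospHom (p (+) q) (superComm X Y).
Proof.
move=> [gX hX] [gY hY]; split; first exact: superComm_gr.
move=> r v w gv; rewrite (superComm_hom gX gY).
rewrite [_ - _]addrC -scaleNr.
rewrite !mulmxDl -!scalemxAl ospForm_linl ospForm_linr -!mulmxA.
have /eqP := hX _ _ w (vecGr_mul gY gv); rewrite addr_eq0 => /eqP ->.
have /eqP := hY _ _ w (vecGr_mul gX gv); rewrite addr_eq0 => /eqP ->.
have /eqP := hX _ _ (Y *m w) gv; rewrite addr_eq0 => /eqP ->.
have /eqP := hY _ _ (X *m w) gv; rewrite addr_eq0 => /eqP ->.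
by case: p q r {gX gY hX hY gv} => [] [] []; rewrite /= ?expr1 ?expr0; ring.
Qed.

Lemma superComm_in X Y :
  X \in osp_pred -> Y \in osp_pred -> superComm X Y \in osp_pred.
Proof.
move=> /asboolP hX /asboolP hY; apply/asboolP => r.
have h p q : ospHom r (glComp r (superComm (glComp p X) (glComp q Y))).
  by have /ospHom_in/asboolP := ospHom_comm (hX p) (hY q).
have D U V : ospHom r (glComp r U) -> ospHom r (glComp r V) ->
    ospHom r (glComp r (U + V)).
  have := glComp_lin r 1 U V; rewrite !scale1r => -> hU hV.
  by rewrite -[glComp r U]scale1r; apply: ospHom_lin.
rewrite (glComp_sum X) (glComp_sum Y) superComm_D !superComm_Dl.
by apply: (D); apply: (D); apply: h.
Qed.

Lemma osp_submod : submod_closed osp_pred.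
Proof.
split; first by apply: (@ospHom_in false); apply: ospHom_0.
move=> c X Y /asboolP hX /asboolP hY; apply/asboolP => p.
by rewrite glComp_lin; apply: ospHom_lin.
Qed.

HB.instance Definition _ :=
  GRing.isSubmodClosed.Build K 'M[K]_N osp_pred osp_submod.

End Gl.

Record ospCar (K : numFieldType) (m n : nat) := OspCar {
  ospMx :> 'M[K]_(m + (n + n));
  ospMxP : ospMx \in @osp_pred K m n }.

Section Osp.
Context (K : numFieldType) (m n : nat).
Local Notation T := (ospCar K m n).

HB.instance Definition _ := [isSub for @ospMx K m n].
HB.instance Definition _ := [Choice of T by <:].
HB.instance Definition _ := [SubChoice_isSubLmodule of T by <:].

Definition ospGr (p : bool) (X : T) : Prop := glGr p (ospMx X).

Definition ospBr (X Y : T) : T := OspCar (superComm_in (ospMxP X) (ospMxP Y)).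

Lemma osp_grading : isGrading ospGr.
Proof.
split.
- by move=> p c u v gu gv; apply: glGr_lin.
- by move=> p; apply: glGr_0.
- move=> X; have /asboolP hX := ospMxP X.
  exists (OspCar (ospHom_in (hX false))); split; first exact: glComp_gr.
  rewrite /ospGr /=.
  have -> : ospMx X - glComp false (ospMx X) = glComp true (ospMx X).
    by rewrite {1}(glComp_sum (ospMx X)) addrC addKr.
  exact: glComp_gr.
- move=> X h0 h1; apply/val_inj/matrixP => i j; rewrite [RHS]mxE.
  have [e|e] := boolP (idxPar i (+) idxPar j == false); first by apply: h1; rewrite (eqP e).
  exact: h0.
Qed.

Lemma osp_linl c (x y z : T) : ospBr (c *: x + y) z = c *: ospBr x z + ospBr y z.
Proof. by apply: val_inj; apply: superComm_linl. Qed.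

Lemma osp_linr c (x y z : T) : ospBr x (c *: y + z) = c *: ospBr x y + ospBr x z.
Proof. by apply: val_inj; apply: superComm_linr. Qed.

Lemma osp_grbr p q (x y : T) :
  ospGr p x -> ospGr q y -> ospGr (p (+) q) (ospBr x y).
Proof. exact: superComm_gr. Qed.

Lemma osp_anti p q (x y : T) : ospGr p x -> ospGr q y ->
  ospBr x y = - ((-1) ^+ (p && q) *: ospBr y x).
Proof. by move=> gx gy; apply: val_inj; apply: superComm_anti. Qed.

Lemma osp_jacobi p q (x y z : T) : ospGr p x -> ospGr q y ->
  ospBr x (ospBr y z)
    = ospBr (ospBr x y) z + (-1) ^+ (p && q) *: ospBr y (ospBr x z).
Proof. by move=> gx gy; apply: val_inj; apply: superComm_jacobi. Qed.

End Osp.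

(* The arguments m, n give osp(m | 2n), of a superspace of dimension (m | 2n). *)
Definition osp (K : numFieldType) (m n : nat) : lieSuperalgebra K :=
  LieSuperalgebra (@osp_grading K m n) (@osp_linl K m n) (@osp_linr K m n)
    (@osp_grbr K m n) (@osp_anti K m n) (@osp_jacobi K m n).

Record isInvariantForm (K : fieldType) (g : lieSuperalgebra K)
    (B : g -> g -> K) : Prop := IsInvariantForm {
  form_linl : forall c x y z, B (c *: x + y) z = c * B x z + B y z;
  form_linr : forall c x y z, B x (c *: y + z) = c * B x y + B x z;
  form_even : forall p q x y, ls_gr p x -> ls_gr q y -> p != q -> B x y = 0;
  form_supersym : forall p q x y,
    ls_gr p x -> ls_gr q y -> B x y = (-1) ^+ (p && q) * B y x;
  form_inv : forall x y z, B (ls_br x y) z = B x (ls_br y z);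
  form_nondeg : forall x, (forall y, B x y = 0) -> x = 0 }.

(* c is the Casimir element of B: for a basis (u_i) of g, with dual basis (y_i)
   on the left, B(y_i, u_j) = delta_ij, it is the sum of the u_i y_i.  This is
   the image in U(g) of the identity of g under End(g) = g (x) g^* = g (x) g, so
   no signs occur and it does not depend on the basis.  Linear independence of
   the u_i follows from the duality. *)
Definition isCasimir (K : fieldType) (g : lieSuperalgebra K)
    (B : g -> g -> K) (c : envAlg g) : Prop :=
  exists (d : nat) (u y : 'I_d -> g),
    [/\ forall x : g, exists a : 'I_d -> K, x = \sum_(i < d) a i *: u i,
        forall i j, B (y i) (u j) = (i == j)%:R
      & c = \sum_(i < d) envIn (u i) * envIn (y i)].

(* Main.v *)
Require Import Defs.
From HB Require Import structures.
From mathcomp Require Import all_boot all_order all_algebra.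
From mathcomp Require Import complex reals.
From mathcomp Require Import ring finmap monalg boolp.
From Stdlib Require Ncring_tac RelationClasses.

Set Implicit Arguments.
Unset Strict Implicit.
Unset Printing Implicit Defensive.

Import GRing.Theory Num.Theory.
Local Open Scope ring_scope.

(** With u = 2 E_+, v = E_- and q = i omega_1, the four elements u, v, u q, v q
    of A_Lambda serve as odd generators of osp(2,2).  The bracket relations only
    use q^2 = -1, the anticommutation of q with u and v, and the two identities
    [v u u - u u v = u] and [v v u - u v v = v]; these also make the Casimir
    element vanish.  The extra generator P goes to omega_1, which commutes with
    the even part and anticommutes with the odd part.  By invariance, a form is
    determined by its values on a root vector of osp(2,2), and weights leave a
    single free value, so all invariant forms are proportional and it suffices
    to compute with one pair of dual bases. *)

Local Notation i0 := (@Ordinal 4 0 isT).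
Local Notation i1 := (@Ordinal 4 1 isT).
Local Notation i2 := (@Ordinal 4 2 isT).
Local Notation i3 := (@Ordinal 4 3 isT).

(** * The relations of osp(2,2) in a ring *)

Section Relations.
Context (B : nzRingType).
(** Registers [B], with Leibniz equality, so that identities of the free noncommutative ring are
    decided automatically. *)
#[local] Instance nc_ops : @Ncring.Ring_ops B 0 1
  +%R *%R (fun x y => x - y) -%R eq := {}.
#[local] Instance nc_ring : Ncring.Ring (Ro := nc_ops).
Proof.
constructor; rewrite /= ?/Algebra_syntax.equality;
  try (by move=> ? ? -> ? ? ->); try (by move=> ? ? ->).
- exact: RelationClasses.eq_equivalence.
- exact: add0r.
- exact: addrC.
- exact: addrA.
- exact: mul1r.
- exact: mulr1.
- exact: mulrA.
- exact: mulrDl.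
- by move=> x y z; apply: mulrDr.
- by [].
- exact: subrr.
Qed.


Ltac nc_ring := Ncring_tac.non_commutative_ring.

(** Reduces an equation to ideal membership: [c] is an explicit two-sided combination of left-hand
    sides of hypotheses, so [x - y = c] is a free ring identity and [c = 0] follows by rewriting. *)
Lemma eq_certificate (c x y : B) : x - y = c -> c = 0 -> x = y.
Proof. by move=> e c0; apply/eqP; rewrite -subr_eq0 e c0. Qed.

Ltac certify c := apply: (@eq_certificate c); first nc_ring.

Section OspRelations.
Context (u v q : B).
Hypothesis uuv : v * u * u - u * u * v - u = 0.
Hypothesis uvv : v * v * u - u * v * v - v = 0.
Hypothesis q2 : q * q + 1 = 0.
Hypothesis uq : u * q + q * u = 0.
Hypothesis vq : v * q + q * v = 0.

Let simp := (uuv, uvv, q2, uq, vq, mul0r, mulr0, subr0, sub0r, oppr0, addr0).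

(** The even generators forced by the odd ones: [genY] is the anticommutator of [v] and [u * q] and
    spans so(2). The sl(2)-triple [genH], [genE], [genF] consists of the anticommutator of [u] and
    [v], minus half that of [u] with itself, and half that of [v] with itself. *)
Definition genY : B := (v * u - u * v) * q.
Definition genH : B := u * v + v * u.
Definition genE : B := - (u * u).
Definition genF : B := v * v.

Lemma acomm_u_uq : u * (u * q) + u * q * u = 0.
Proof. by certify (u * (u * q + q * u)); rewrite !simp. Qed.

Lemma acomm_v_vq : v * (v * q) + v * q * v = 0.
Proof. by certify (v * (v * q + q * v)); rewrite !simp. Qed.

Lemma acomm_u_vq : u * (v * q) + v * q * u = - genY.
Proof. by rewrite /genY; certify (v * (u * q + q * u)); rewrite !simp. Qed.

Lemma acomm_v_uq : v * (u * q) + u * q * v = genY.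
Proof. by rewrite /genY; certify (u * (v * q + q * v)); rewrite !simp. Qed.

(** Moving [q] past [u] costs a sign, which [q * q = -1] cancels. *)
Lemma mulq_u x : x * q * (u * q) = x * u.
Proof.
by certify (x * (u * q + q * u) * q - x * u * (q * q + 1)); rewrite !simp.
Qed.

Lemma mulq_v x : x * q * (v * q) = x * v.
Proof.
by certify (x * (v * q + q * v) * q - x * v * (q * q + 1)); rewrite !simp.
Qed.

(** Since [q] anticommutes with [u] and [v], it commutes with every word of even degree in them; the
    next three lemmas have the same reason. *)
Lemma comm_q_Y : q * genY - genY * q = 0.
Proof.
rewrite /genY.
by certify ((v * q + q * v) * u * q - v * (u * q + q * u) * q
  - (u * q + q * u) * v * q + u * (v * q + q * v) * q); rewrite !simp.
Qed.

Lemma comm_q_H : q * genH - genH * q = 0.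
Proof.
rewrite /genH.
by certify ((v * q + q * v) * u - v * (u * q + q * u)
  + (u * q + q * u) * v - u * (v * q + q * v)); rewrite !simp.
Qed.

Lemma comm_q_E : q * genE - genE * q = 0.
Proof.
rewrite /genE.
by certify (u * (u * q + q * u) - (u * q + q * u) * u); rewrite !simp.
Qed.

Lemma comm_q_F : q * genF - genF * q = 0.
Proof.
rewrite /genF.
by certify ((v * q + q * v) * v - v * (v * q + q * v)); rewrite !simp.
Qed.

(** Derives the brackets of even elements with [u * q] and [v * q] from those with [u] and [v]. *)
Lemma comm_mulq (x y : B) :
  q * x - x * q = 0 -> x * (y * q) - y * q * x = (x * y - y * x) * q.
Proof. by move=> qx; certify (- (y * (q * x - x * q))); rewrite qx !simp. Qed.

(** Moving [q] to the right turns the commutator into minus the anticommutator of [v * u - u * v]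
    with [u], times [q]. That anticommutator telescopes to [v * u * u - u * u * v], which is [u]. *)
Lemma comm_Y_u : genY * u - u * genY = - (u * q).
Proof.
rewrite /genY; certify ((v * u - u * v) * (u * q + q * u)
  - (v * u * u - u * u * v - u) * q).
by rewrite !simp.
Qed.

Lemma comm_Y_v : genY * v - v * genY = - (v * q).
Proof.
rewrite /genY; certify ((v * u - u * v) * (v * q + q * v)
  - (v * v * u - u * v * v - v) * q).
by rewrite !simp.
Qed.

Lemma comm_Y_uq : genY * (u * q) - u * q * genY = u.
Proof.
rewrite (comm_mulq _ comm_q_Y) comm_Y_u; certify (- (u * (q * q + 1))).
by rewrite !simp.
Qed.

Lemma comm_Y_vq : genY * (v * q) - v * q * genY = v.
Proof.
rewrite (comm_mulq _ comm_q_Y) comm_Y_v; certify (- (v * (q * q + 1))).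
by rewrite !simp.
Qed.

Lemma comm_H_u : genH * u - u * genH = u.
Proof. by rewrite /genH; certify (v * u * u - u * u * v - u). Qed.

Lemma comm_H_v : genH * v - v * genH = - v.
Proof. by rewrite /genH; certify (- (v * v * u - u * v * v - v)); rewrite !simp. Qed.

Lemma comm_E_u : genE * u - u * genE = 0.
Proof. by rewrite /genE; nc_ring. Qed.

Lemma comm_E_v : genE * v - v * genE = u.
Proof. by rewrite /genE; certify (v * u * u - u * u * v - u). Qed.

Lemma comm_F_u : genF * u - u * genF = v.
Proof. by rewrite /genF; certify (v * v * u - u * v * v - v). Qed.

Lemma comm_F_v : genF * v - v * genF = 0.
Proof. by rewrite /genF; nc_ring. Qed.

(** Leibniz rule; it yields the brackets between even elements, which are quadratic in the odd
    ones. *)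
Lemma commM (x y z : B) :
  x * (y * z) - y * z * x = (x * y - y * x) * z + y * (x * z - z * x).
Proof. nc_ring. Qed.

Lemma comm_Y_H : genY * genH - genH * genY = 0.
Proof.
have -> : genY * genH - genH * genY
    = (genY * (u * v) - u * v * genY) + (genY * (v * u) - v * u * genY).
  by rewrite /genH; nc_ring.
rewrite !commM comm_Y_u comm_Y_v.
by certify (- (u * (v * q + q * v)) - v * (u * q + q * u)); rewrite !simp.
Qed.

Lemma comm_Y_E : genY * genE - genE * genY = 0.
Proof.
rewrite {1 2}/genE mulrN mulNr -opprD commM comm_Y_u.
by certify (u * (u * q + q * u)); rewrite !simp.
Qed.

Lemma comm_Y_F : genY * genF - genF * genY = 0.
Proof.
rewrite commM comm_Y_v.
by certify (- (v * (v * q + q * v))); rewrite !simp.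
Qed.

Lemma comm_H_E : genH * genE - genE * genH = genE + genE.
Proof. by rewrite /genE mulrN mulNr -opprD commM comm_H_u opprD. Qed.

Lemma comm_H_F : genH * genF - genF * genH = - (genF + genF).
Proof. by rewrite commM comm_H_v /genF; nc_ring. Qed.

Lemma comm_E_F : genE * genF - genF * genE = genH.
Proof. by rewrite commM comm_E_v. Qed.

(** The left side is the Casimir element, up to a scalar, in the basis used below. As [q] drops out,
    [Y^2 = -(vu - uv)^2] and the two odd pairs coincide. The rest is twice
    [u (vvu - uvv - v) - v (vuu - uuv - u)]. *)
Lemma casimir_eq0 :
  genY * genY + (genH * genH + (genE * genF + genE * genF
  + (genF * genE + genF * genE + (- (u * v) + (v * u
  + (- (u * q * (v * q)) + v * q * (u * q))))))) = 0.
Proof.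
have -> : genY * genY = - ((v * u - u * v) * (v * u - u * v)).
  rewrite /genY; certify ((v * u - u * v) *
    ((v * q + q * v) * u - v * (u * q + q * u) - (u * q + q * u) * v
     + u * (v * q + q * v)) * q
    + (v * u - u * v) * (v * u - u * v) * (q * q + 1)).
  by rewrite !simp.
rewrite mulq_u mulq_v /genE /genF /genH.
certify ((u * (v * v * u - u * v * v - v) - v * (v * u * u - u * u * v - u))
  + (u * (v * v * u - u * v * v - v) - v * (v * u * u - u * u * v - u))).
by rewrite !simp.
Qed.

End OspRelations.

(** * The cubic relations in the algebra A_Lambda *)

Section AlgebraRelations.
Context (ep em om la c : B).
Hypothesis comm_c_em : c * em - em * c = 0.
Hypothesis c4 : c + c + c + c - 1 = 0.
Hypothesis la_ep : la * ep - ep * la = 0.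
Hypothesis la_em : la * em - em * la = 0.
Hypothesis ep_om : ep * om + om * ep = 0.
Hypothesis em_om : em * om + om * em = 0.
Hypothesis ep_em : ep * em - em * ep - (- c + la * om) = 0.

Let simp := (comm_c_em, c4, la_ep, la_em, ep_om, em_om, ep_em,
  mul0r, mulr0, subr0, sub0r, oppr0, addr0).

(** Here [c] stands for 1/4. By the Leibniz rule [[em, ep^2] = [em, ep] ep + ep [em, ep]] with
    [[em, ep] = c - la om]. The terms in [la om] cancel, as [la] commutes with [ep] and [om]
    anticommutes with it; the terms in [c] leave [ep / 2]. The next lemma treats [[em^2, ep]]
    likewise. *)
Lemma commutator_uuv :
  em * (ep + ep) * (ep + ep) - (ep + ep) * (ep + ep) * em - (ep + ep) = 0.
Proof.
pose z := ep * em - em * ep - (- c + la * om).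
pose x := (c + c + c + c - 1) * ep + ep * (c + c + c + c - 1).
pose y := (la * ep - ep * la) * om - la * (ep * om + om * ep)
  - (z * ep + ep * z).
apply: (@eq_certificate (x + (y + y + y + y))).
  by rewrite /x /y /z; nc_ring.
by rewrite /x /y /z !simp.
Qed.

Lemma commutator_uvv :
  em * em * (ep + ep) - (ep + ep) * em * em - em = 0.
Proof.
pose z := ep * em - em * ep - (- c + la * om).
pose y := (la * em - em * la) * om - la * (em * om + om * em)
  - (c * em - em * c) - (z * em + em * z).
apply: (@eq_certificate ((c + c + c + c - 1) * em + (y + y))).
  by rewrite /y /z; nc_ring.
by rewrite /y /z !simp.
Qed.

End AlgebraRelations.
End Relations.

(** * Smash products and presentations *)

(** Universal property of the smash product: [a + b P] goes to [f a + f b * w]. *)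
Lemma smash_lift (K : fieldType) (A : superAlgebra K) (B : algType K)
    (f : {lrmorphism A -> B}) (w : B) :
  w * w = 1 ->
  (forall p a, sa_gr p a -> w * f a = (-1) ^+ p *: (f a * w)) ->
  exists h : {lrmorphism smash A -> B},
    (forall a, h (smashIn a) = f a) /\ h (smashP A) = w.
Proof.
move=> w2 wf.
(* By linearity the sign rule on homogeneous elements becomes a twist by the parity map, as in the
   product of the smash algebra. *)
have wE a : w * f a = f (parityMap (sa_grading A) a) * w.
  have [a0 [a1 [e0 e1 ->]]] := gr_split (sa_grading A) a.
  rewrite parity_add (parityMap_homog _ e0) (parityMap_homog _ e1).
  rewrite !rmorphD /= mulrDr mulrDl (wf _ _ e0) (wf _ _ e1) !linearZ /=.
  by rewrite -!scalerAl.
pose h (x : smash A) : B := f (smash0 x) + f (smash1 x) * w.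
have hB : zmod_morphism h.
  move=> x y; rewrite /h /= !rmorphB /= mulrBl opprD !addrA.
  by congr (_ + _); rewrite addrAC.
have hM : monoid_morphism h.
  split; first by rewrite /h rmorph1 rmorph0 mul0r addr0.
  move=> x y; rewrite /h /= !rmorphD !rmorphM /= mulrDl !mulrDr !mulrDl.
  rewrite !mulrA -[_ * w * f (smash0 y)]mulrA -[_ * w * f (smash1 y)]mulrA !wE.
  rewrite !mulrA -[_ * _ * w * w]mulrA w2 mulr1 -!addrA.
  by congr (_ + _); rewrite addrC -addrA [RHS]addrCA.
have hZ : scalable h.
  by move=> c x; rewrite /h /= !linearZ /= -scalerAl scalerDr.
pose m1 := GRing.isZmodMorphism.Build (smash A) B h hB.
pose m2 := GRing.isMonoidMorphism.Build (smash A) B h hM.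
pose m3 := GRing.isScalable.Build K (smash A) B *:%R h hZ.
pose h' : {lrmorphism smash A -> B} := HB.pack h m1 m2 m3.
exists h'; split=> [a|]; rewrite /= /h /=.
  by rewrite rmorph0 mul0r addr0.
by rewrite rmorph0 rmorph1 mul1r add0r.
Qed.

(** Words span the free algebra, and a word arises from 1 by prepending letters. *)
Lemma freeAlg_ind (K : fieldType) (X : choiceType) (D : freeAlg K X -> Prop) :
  D 1 -> (forall c a b, D a -> D b -> D (c *: a + b)) ->
  (forall x a, D a -> D (gen K x * a)) -> forall a, D a.
Proof.
move=> D1 DL DM f.
have D0 : D 0 by have := DL (-1) _ _ D1 D1; rewrite scaleN1r addNr.
rewrite [f]monalgE; elim/big_rec: _ => // m a _ Da.
have -> : << f@_m *g m >> + a = f@_m *: << m >> + a :> freeAlg K X.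
  by rewrite malgZ_monom.
apply: DL Da; case: m => s; elim: s => [|x s IHs].
  by move: D1; congr D; rewrite -fmoneE.
have -> : << FMonom (x :: s) >> = gen K x * << FMonom s >> :> freeAlg K X.
  by rewrite /gen -lock malgM_def fgmulUU mulr1 /mmul /= fmmulE fmuE.
exact: DM.
Qed.

Section AL.
Context (K : fieldType).

Lemma AL_presentation : exists p : {lrmorphism freeAlg K ALgen -> AL K},
  (forall a, ALrel a -> p a = 0) /\ forall b, exists a, p a = b.
Proof.
exists (quotProj (@ALrel_proper K)); split; last exact: quotProj_surj.
move=> a Ra; apply: etrans (rmorph0 (quotProj (@ALrel_proper K))).
by apply/quotProjP; rewrite subr0; apply: genIdeal_in.
Qed.

(** Collects what the rest of the proof uses about A_Lambda. The last clause, an induction principle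
    saying that the [t x] generate, is the source of surjectivity. *)
Lemma AL_generators : exists t : ALgen -> AL K,
  [/\ forall x, t La * t x = t x * t La, t Om * t Om = 1,
      t Ep * t Om + t Om * t Ep = 0 /\ t Em * t Om + t Om * t Em = 0,
      t Ep * t Em - t Em * t Ep = - (4%:R^-1)%:A + t La * t Om
    & forall D : AL K -> Prop, D 1 ->
      (forall c a b, D a -> D b -> D (c *: a + b)) ->
      (forall x a, D a -> D (t x * a)) -> forall a, D a].
Proof.
have [p [pR psurj]] := AL_presentation.
have pM a b : p (a * b) = p a * p b by exact: rmorphM.
have pD a b : p (a + b) = p a + p b by exact: rmorphD.
have pN a : p (- a) = - p a by exact: rmorphN.
have pZ c a : p (c *: a) = c *: p a by exact: linearZ.
have p1 : p 1 = 1 by exact: rmorph1.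
exists (fun x => p (gen K x)); split.
- move=> x; have := pR _ (AL_central K x).
  by rewrite pD pN 2!pM => /eqP; rewrite subr_eq0 => /eqP.
- have := pR _ (AL_omega2 K).
  by rewrite expr2 pD pN pM p1 => /eqP; rewrite subr_eq0 => /eqP.
- by split; rewrite -!pM -pD; apply: pR; [apply: AL_omegaEp | apply: AL_omegaEm].
- have pE k a b c d l o : p (a * b - c * d - (- k%:A + l * o))
      = p a * p b - p c * p d - (- k%:A + p l * p o).
    by rewrite !(pD, pN, pM, pZ) p1.
  by apply/eqP; rewrite -subr_eq0 -pE; apply/eqP/pR/AL_comm.
- move=> D D1 DL DM a; have [f <-] := psurj a.
  elim/freeAlg_ind: f => [|c a1 a2 Da1 Da2|x a1 Da1].
  + by rewrite p1.
  + by rewrite pD pZ; apply: DL.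
  + by rewrite pM; apply: DM.
Qed.

End AL.

(** * Coordinates on osp(2,2) *)

Lemma sum4 (V : nmodType) (F : 'I_4 -> V) :
  \sum_(i < 4) F i = F i0 + F i1 + F i2 + F i3.
Proof.
rewrite !big_ord_recr big_ord0 /= add0r.
by congr (F _ + F _ + F _ + F _); apply: val_inj.
Qed.

Lemma ord4P (P : 'I_4 -> Prop) : P i0 -> P i1 -> P i2 -> P i3 -> forall i, P i.
Proof.
move=> P0 P1 P2 P3 [[|[|[|[|k]]]] Hk] //.
- by rewrite (_ : Ordinal Hk = i0) //; apply: val_inj.
- by rewrite (_ : Ordinal Hk = i1) //; apply: val_inj.
- by rewrite (_ : Ordinal Hk = i2) //; apply: val_inj.
- by rewrite (_ : Ordinal Hk = i3) //; apply: val_inj.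
Qed.

Section Osp.
Context (K : numFieldType).
Local Notation g := (osp K 2 1).

(* a is the coordinate of so(2), (h, e, f) those of sp(2) = sl(2), and p, q, r, s
   those of the odd part. *)
Definition mkMx (a h e f p q r s : K) : 'M[K]_(2 + (1 + 1)) :=
  \matrix_(i, j) nth 0 (nth [::] [:: [:: 0; a; q; - p];
                                     [:: - a; 0; s; - r];
                                     [:: p; r; h; e];
                                     [:: q; s; f; - h]] i) j.

Lemma ospFormE (v w : 'cV[K]_(2 + (1 + 1))) :
  ospForm v w = v i0 0 * w i0 0 + v i1 0 * w i1 0 + v i2 0 * w i3 0
                - v i3 0 * w i2 0.
Proof.
rewrite /ospForm mxE sum4 !mxE !sum4 /ospFormMx.
(* Flat indices are rewritten as positions in the nested blocks of [ospFormMx]. *)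
have e0 : i0 = lshift (1 + 1) (ord0 : 'I_2) by apply: val_inj.
have e1 : i1 = lshift (1 + 1) (ord_max : 'I_2) by apply: val_inj.
have e2 : i2 = rshift 2 (lshift 1 (ord0 : 'I_1)) by apply: val_inj.
have e3 : i3 = rshift 2 (rshift 1 (ord0 : 'I_1)) by apply: val_inj.
rewrite e0 e1 e2 e3.
rewrite !(block_mxEul, block_mxEur, block_mxEdl, block_mxEdr, mxE) /=.
by ring.
Qed.

Lemma mulmx_cV (X : 'M[K]_(2 + (1 + 1))) (v : 'cV_(2 + (1 + 1))) i :
  (X *m v) i 0 = X i i0 * v i0 0 + X i i1 * v i1 0 + X i i2 * v i2 0
                 + X i i3 * v i3 0.
Proof. by rewrite mxE sum4. Qed.

Lemma mkMx_even a h e f : ospHom false (mkMx a h e f 0 0 0 0).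
Proof.
split.
  by elim/ord4P; elim/ord4P; rewrite mxE //= oppr0.
move=> r v w _; rewrite !ospFormE !mulmx_cV !mxE /=; ring.
Qed.

Lemma mkMx_odd p q r s : ospHom true (mkMx 0 0 0 0 p q r s).
Proof.
split.
  by elim/ord4P; elim/ord4P; rewrite mxE //= oppr0.
move=> b v w gv; rewrite !ospFormE !mulmx_cV !mxE /=.
(* The sign depends on the parity of [v], which also makes two coordinates of [v] vanish. *)
case: b gv => gv.
  rewrite (gv i0 isT) (gv i1 isT); ring.
rewrite (gv i2 isT) (gv i3 isT); ring.
Qed.

Lemma mkMx_split a h e f p q r s :
  mkMx a h e f p q r s = mkMx a h e f 0 0 0 0 + mkMx 0 0 0 0 p q r s.
Proof.
by apply/matrixP; elim/ord4P; elim/ord4P; rewrite !mxE /= ?oppr0 ?addr0 ?add0r.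
Qed.

Lemma mkMx_in a h e f p q r s : mkMx a h e f p q r s \in @osp_pred K 2 1.
Proof.
rewrite mkMx_split rpredD //; apply: ospHom_in.
  exact: mkMx_even.
exact: mkMx_odd.
Qed.

Definition mkOsp a h e f p q r s : g := OspCar (mkMx_in a h e f p q r s).

(** The defining condition of osp, tested on two standard basis vectors. *)
Lemma osp_eqn p i j (x : g) :
  ospForm (glComp p (ospMx x) *m delta_mx i 0) (delta_mx j 0)
  + (-1) ^+ (p && idxPar i) * ospForm (delta_mx i 0)
      (glComp p (ospMx x) *m delta_mx j 0) = 0.
Proof.
have /asboolP hx := ospMxP x; apply: (hx p).2 => k; rewrite mxE.
by case: (k =P i) => [->|_] //; rewrite eqxx.
Qed.

Lemma osp_coords (x : g) : x = mkOsp (x i0 i1) (x i2 i2) (x i2 i3) (x i3 i2)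
  (x i2 i0) (x i3 i0) (x i2 i1) (x i3 i1).
Proof.
have H p i j := osp_eqn p i j x.
(* Four even instances kill the diagonal of the so(2) block, make it antisymmetric and the sp(2)
   block traceless; four odd ones express the upper right block through the lower left one. *)
have := H true i1 i3; have := H true i1 i2.
have := H true i0 i3; have := H true i0 i2.
have := H false i2 i3; have := H false i0 i1.
have := H false i1 i1; have := H false i0 i0.
rewrite !ospFormE !mulmx_cV !mxE /=.
rewrite !(mulr0, mulr1, mul0r, mul1r, addr0, add0r, subr0, sub0r, expr0).
rewrite -!mulr2n => /eqP; rewrite mulrn_eq0 /= => /eqP x00.
move=> /eqP; rewrite mulrn_eq0 /= => /eqP x11.
move=> /eqP; rewrite addr_eq0 => /eqP x10 /eqP; rewrite addr_eq0 => /eqP x22.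
move=> /eqP; rewrite addrC subr_eq0 => /eqP x02.
move=> /eqP; rewrite addrC addr_eq0 => /eqP x03.
move=> /eqP; rewrite addrC subr_eq0 => /eqP x12.
move=> /eqP; rewrite addrC addr_eq0 => /eqP x13.
apply: val_inj; apply/matrixP; elim/ord4P; elim/ord4P; rewrite !mxE //=.
by rewrite x22 opprK.
Qed.

(** All structure constants at once. Splitting both arguments by parity turns the superbracket into
    signed matrix commutators. *)
Lemma ospBr_mk a h e f p q r s a' h' e' f' p' q' r' s' :
  ls_br (mkOsp a h e f p q r s) (mkOsp a' h' e' f' p' q' r' s') =
  mkOsp (q * r' - p * s' + q' * r - p' * s)
    (p * q' + r * s' + p' * q + r' * s + e * f' - f * e')
    (- (p * p' + r * r') *+ 2 + (h * e' - e * h') *+ 2)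
    ((q * q' + s * s') *+ 2 - (h * f' - f * h') *+ 2)
    (h * p' + e * q' - h' * p - e' * q + a * r' - a' * r)
    (f * p' - h * q' - f' * p + h' * q + a * s' - a' * s)
    (h * r' + e * s' - h' * r - e' * s - a * p' + a' * p)
    (f * r' - h * s' - f' * r + h' * s - a * q' + a' * q).
Proof.
apply: val_inj; rewrite /= mkMx_split [mkMx a' h' _ _ _ _ _ _]mkMx_split.
rewrite superComm_Dl !superComm_D.
rewrite (superComm_hom (mkMx_even _ _ _ _).1 (mkMx_even _ _ _ _).1).
rewrite (superComm_hom (mkMx_even _ _ _ _).1 (mkMx_odd _ _ _ _).1).
rewrite (superComm_hom (mkMx_odd _ _ _ _).1 (mkMx_even _ _ _ _).1).
rewrite (superComm_hom (mkMx_odd _ _ _ _).1 (mkMx_odd _ _ _ _).1).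
apply/matrixP; elim/ord4P; elim/ord4P; rewrite !mxE !sum4 !mxE /=; ring.
Qed.

Lemma mkOsp_lin c a h e f p q r s a' h' e' f' p' q' r' s' :
  c *: mkOsp a h e f p q r s + mkOsp a' h' e' f' p' q' r' s' =
  mkOsp (c * a + a') (c * h + h') (c * e + e') (c * f + f')
    (c * p + p') (c * q + q') (c * r + r') (c * s + s').
Proof.
apply: val_inj; apply/matrixP; elim/ord4P; elim/ord4P; rewrite !mxE /=; ring.
Qed.

Lemma mkOsp_even a h e f : ls_gr false (mkOsp a h e f 0 0 0 0).
Proof. exact: (mkMx_even _ _ _ _).1. Qed.

Lemma mkOsp_odd p q r s : ls_gr true (mkOsp 0 0 0 0 p q r s).
Proof. exact: (mkMx_odd _ _ _ _).1. Qed.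

Lemma osp_evenE (x : g) : ls_gr false x ->
  x = mkOsp (x i0 i1) (x i2 i2) (x i2 i3) (x i3 i2) 0 0 0 0.
Proof.
move=> gx; rewrite {1}(osp_coords x).
by rewrite (gx i2 i0 isT) (gx i3 i0 isT) (gx i2 i1 isT) (gx i3 i1 isT).
Qed.

Lemma osp_oddE (x : g) : ls_gr true x ->
  x = mkOsp 0 0 0 0 (x i2 i0) (x i3 i0) (x i2 i1) (x i3 i1).
Proof.
move=> gx; rewrite {1}(osp_coords x).
by rewrite (gx i0 i1 isT) (gx i2 i2 isT) (gx i2 i3 isT) (gx i3 i2 isT).
Qed.

End Osp.

(** * A homogeneous basis of osp(2,2) *)

Section OspBasis.
Context (K : numFieldType).
Local Notation g := (osp K 2 1).

Definition ospY : g := mkOsp 1 0 0 0 0 0 0 0.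
Definition ospH : g := mkOsp 0 1 0 0 0 0 0 0.
Definition ospE : g := mkOsp 0 0 1 0 0 0 0 0.
Definition ospF : g := mkOsp 0 0 0 1 0 0 0 0.
Definition ospU : g := mkOsp 0 0 0 0 1 0 0 0.
Definition ospV : g := mkOsp 0 0 0 0 0 1 0 0.
Definition ospU' : g := mkOsp 0 0 0 0 0 0 1 0.
Definition ospV' : g := mkOsp 0 0 0 0 0 0 0 1.

Let simp := (mulr0, mulr1, mul0r, mul1r, addr0, add0r, subr0, sub0r, oppr0,
  mul0rn).

Lemma mkOsp0 : mkOsp 0 0 0 0 0 0 0 0 = 0 :> g.
Proof.
by have := mkOsp_lin (-1 : K) 0 0 0 0 0 0 0 0 0 0 0 0 0 0 0 0;
  rewrite scaleN1r addNr !simp.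
Qed.

(** The final [+ 0] gives every partial sum the shape [c *: x + y] of the linearity hypotheses. *)
Lemma mkOsp_evenD (a h e f : K) : mkOsp a h e f 0 0 0 0 =
  a *: ospY + (h *: ospH + (e *: ospE + (f *: ospF + 0))).
Proof. by rewrite -mkOsp0 !mkOsp_lin !simp. Qed.

Lemma mkOsp_oddD (p q r s : K) : mkOsp 0 0 0 0 p q r s =
  p *: ospU + (q *: ospV + (r *: ospU' + (s *: ospV' + 0))).
Proof. by rewrite -mkOsp0 !mkOsp_lin !simp. Qed.

Lemma mkOspD (a h e f p q r s : K) : mkOsp a h e f p q r s =
  a *: ospY + (h *: ospH + (e *: ospE + (f *: ospF +
  (p *: ospU + (q *: ospV + (r *: ospU' + (s *: ospV' + 0))))))).
Proof. by rewrite -mkOsp0 !mkOsp_lin !simp. Qed.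

Section Closed.
Context (D : g -> Prop).
Hypothesis D0 : D 0.
Hypothesis DL : forall c x y, D x -> D y -> D (c *: x + y).

Lemma osp_even_ind : D ospY -> D ospH -> D ospE -> D ospF ->
  forall x : g, ls_gr false x -> D x.
Proof.
move=> dY dH dE dF x gx; rewrite (osp_evenE gx) mkOsp_evenD.
by do !apply: DL.
Qed.

Lemma osp_odd_ind : D ospU -> D ospV -> D ospU' -> D ospV' ->
  forall x : g, ls_gr true x -> D x.
Proof.
move=> dU dV dU' dV' x gx; rewrite (osp_oddE gx) mkOsp_oddD.
by do !apply: DL.
Qed.

End Closed.

(** * The homomorphism from the enveloping algebra given by [u], [v] and [q] *)

Section Hom.
Context (B : algType K) (u v q : B).
Hypothesis uuv : v * u * u - u * u * v - u = 0.
Hypothesis uvv : v * v * u - u * v * v - v = 0.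
Hypothesis q2 : q * q + 1 = 0.
Hypothesis uq : u * q + q * u = 0.
Hypothesis vq : v * q + q * v = 0.

Definition ospMap (x : g) : B :=
  x i0 i1 *: genY u v q + x i2 i2 *: genH u v + x i2 i3 *: genE u
  + x i3 i2 *: genF v + x i2 i0 *: u + x i3 i0 *: v + x i2 i1 *: (u * q)
  + x i3 i1 *: (v * q).

Lemma ospMap_mk a h e f p b r s : ospMap (mkOsp a h e f p b r s) =
  a *: genY u v q + h *: genH u v + e *: genE u + f *: genF v + p *: u
  + b *: v + r *: (u * q) + s *: (v * q).
Proof. by rewrite /ospMap /= !mxE. Qed.

Lemma ospMap_lin c x y : ospMap (c *: x + y) = c *: ospMap x + ospMap y.
Proof.
rewrite (osp_coords x) (osp_coords y) mkOsp_lin !ospMap_mk.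
rewrite !scalerDl -!scalerA !scalerDr.
do 7 (rewrite [RHS]addrACA; congr (_ + _)).
Qed.

Let simpM := (simp, scale0r, scale1r, scaleN1r, @opprK, @mulr2n).

(** For a fixed sign [s] the relation is stable under linear combinations in each argument, so for
    each pair of parities it need only be checked on basis vectors. *)
Let ospRel (s : K) (x y : g) :=
  ospMap x * ospMap y - s *: (ospMap y * ospMap x) = ospMap (ls_br x y).

Lemma ospMap0 : ospMap 0 = 0.
Proof. by rewrite -mkOsp0 ospMap_mk !scale0r !addr0. Qed.

Lemma ospRel_linr s x c y z :
  ospRel s x y -> ospRel s x z -> ospRel s x (c *: y + z).
Proof.
rewrite /ospRel ls_linr !ospMap_lin => <- <-.
move: (ospMap x) (ospMap y) (ospMap z) => a b d.
rewrite mulrDr mulrDl -scalerAr -scalerAl scalerDr scalerBr !scalerA.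
by rewrite [s * c]mulrC opprD addrACA.
Qed.

Lemma ospRel_linl s x c y z :
  ospRel s y x -> ospRel s z x -> ospRel s (c *: y + z) x.
Proof.
rewrite /ospRel ls_linl !ospMap_lin => <- <-.
move: (ospMap x) (ospMap y) (ospMap z) => a b d.
rewrite mulrDr mulrDl -scalerAr -scalerAl scalerDr scalerBr !scalerA.
by rewrite [s * c]mulrC opprD addrACA.
Qed.

Lemma br0r x : ls_br x 0 = 0 :> g.
Proof. by have := ls_linr (-1) x 0 0; rewrite !scaleN1r !addNr. Qed.

Lemma br0l x : ls_br 0 x = 0 :> g.
Proof. by have := ls_linl (-1) 0 0 x; rewrite !scaleN1r !addNr. Qed.

Lemma ospRel0r s x : ospRel s x 0.
Proof. by rewrite /ospRel br0r ospMap0 mulr0 mul0r scaler0 subrr. Qed.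

Lemma ospRel0l s x : ospRel s 0 x.
Proof. by rewrite /ospRel br0l ospMap0 mulr0 mul0r scaler0 subrr. Qed.


(** Super-antisymmetry of the bracket; it halves the number of pairs to check. *)
Lemma ospRel_sym p r x y : ls_gr p x -> ls_gr r y ->
  ospRel ((-1) ^+ (p && r)) x y -> ospRel ((-1) ^+ (p && r)) y x.
Proof.
move=> gx gy; rewrite /ospRel (ls_anti gx gy).
have -> c z : ospMap (- (c *: z)) = - c *: ospMap z.
  by rewrite -scaleNr -[X in ospMap X]addr0 ospMap_lin ospMap0 addr0.
(* Multiplying by the invertible factor [- (-1) ^+ (p && r)] exchanges the two relations. *)
move: (ospMap x) (ospMap y) => a b e; apply: (scalerI (a := - (-1) ^+ (p && r))).
  by rewrite oppr_eq0 signr_eq0.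
rewrite -e scalerBr scalerA mulNr -signr_addb addbb !scaleNr scale1r opprK.
by rewrite addrC.
Qed.

Ltac relation := rewrite /ospRel ospBr_mk !ospMap_mk !simpM.


Let ospRel_evenl s y :
  ospRel s ospY y -> ospRel s ospH y -> ospRel s ospE y -> ospRel s ospF y ->
  forall x, ls_gr false x -> ospRel s x y.
Proof.
by move=> *; apply: (osp_even_ind
  (ospRel0l s y) (fun c x1 x2 => @ospRel_linl s y c x1 x2)).
Qed.

Let ospRel_evenr s x :
  ospRel s x ospY -> ospRel s x ospH -> ospRel s x ospE -> ospRel s x ospF ->
  forall y, ls_gr false y -> ospRel s x y.
Proof.
by move=> *; apply: (osp_even_ind
  (ospRel0r s x) (fun c y1 y2 => @ospRel_linr s x c y1 y2)).
Qed.

Let ospRel_oddl s y :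
  ospRel s ospU y -> ospRel s ospV y -> ospRel s ospU' y -> ospRel s ospV' y ->
  forall x, ls_gr true x -> ospRel s x y.
Proof.
by move=> *; apply: (osp_odd_ind
  (ospRel0l s y) (fun c x1 x2 => @ospRel_linl s y c x1 x2)).
Qed.

Let ospRel_oddr s x :
  ospRel s x ospU -> ospRel s x ospV -> ospRel s x ospU' -> ospRel s x ospV' ->
  forall y, ls_gr true y -> ospRel s x y.
Proof.
by move=> *; apply: (osp_odd_ind
  (ospRel0r s x) (fun c y1 y2 => @ospRel_linr s x c y1 y2)).
Qed.

Lemma ospRel_even_even x y : ls_gr false x -> ls_gr false y -> ospRel 1 x y.
Proof.
move=> gx gy.
have YH : ospRel 1 ospY ospH by relation; rewrite comm_Y_H.
have YE : ospRel 1 ospY ospE by relation; rewrite comm_Y_E.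
have YF : ospRel 1 ospY ospF by relation; rewrite comm_Y_F.
have HE : ospRel 1 ospH ospE by relation; rewrite comm_H_E // scalerDl scale1r.
have HF : ospRel 1 ospH ospF.
  by relation; rewrite comm_H_F // scaleNr scalerDl scale1r.
have EF : ospRel 1 ospE ospF by relation; rewrite comm_E_F.
have YY : ospRel 1 ospY ospY by relation; rewrite subrr.
have HH : ospRel 1 ospH ospH by relation; rewrite subrr.
have EE : ospRel 1 ospE ospE by relation; rewrite subrr.
have FF : ospRel 1 ospF ospF by relation; rewrite subrr.
have HY := ospRel_sym (mkOsp_even _ _ _ _) (mkOsp_even _ _ _ _) YH.
have EY := ospRel_sym (mkOsp_even _ _ _ _) (mkOsp_even _ _ _ _) YE.
have FY := ospRel_sym (mkOsp_even _ _ _ _) (mkOsp_even _ _ _ _) YF.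
have EH := ospRel_sym (mkOsp_even _ _ _ _) (mkOsp_even _ _ _ _) HE.
have FH := ospRel_sym (mkOsp_even _ _ _ _) (mkOsp_even _ _ _ _) HF.
have FE := ospRel_sym (mkOsp_even _ _ _ _) (mkOsp_even _ _ _ _) EF.
exact: (ospRel_evenl (ospRel_evenr YY YH YE YF gy) (ospRel_evenr HY HH HE HF gy)
  (ospRel_evenr EY EH EE EF gy) (ospRel_evenr FY FH FE FF gy) gx).
Qed.

Lemma ospRel_even_odd x y : ls_gr false x -> ls_gr true y -> ospRel 1 x y.
Proof.
move=> gx gy; apply: ospRel_evenl gx; apply: ospRel_oddr gy; relation.
- exact: comm_Y_u.
- exact: comm_Y_v.
- exact: comm_Y_uq.
- exact: comm_Y_vq.
- exact: comm_H_u.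
- by rewrite comm_H_v //.
- by rewrite (comm_mulq _ (comm_q_H uq vq)) comm_H_u.
- by rewrite (comm_mulq _ (comm_q_H uq vq)) comm_H_v // mulNr.
- exact: comm_E_u.
- exact: comm_E_v.
- by rewrite (comm_mulq _ (comm_q_E uq)) comm_E_u mul0r.
- by rewrite (comm_mulq _ (comm_q_E uq)) comm_E_v.
- exact: comm_F_u.
- exact: comm_F_v.
- by rewrite (comm_mulq _ (comm_q_F vq)) comm_F_u.
- by rewrite (comm_mulq _ (comm_q_F vq)) comm_F_v mul0r.
Qed.

Lemma ospRel_odd_odd x y : ls_gr true x -> ls_gr true y -> ospRel (-1) x y.
Proof.
move=> gx gy.
(* In the shape left by [relation], these close [UU] and [VV] and, once [q] is removed, [U'U'] and
   [V'V']. *)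
have uu : u * u + u * u = (-1 - 1) *: genE u.
  by rewrite scalerDl scaleN1r /genE opprK.
have vv : v * v + v * v = (1 + 1) *: genF v by rewrite scalerDl scale1r.
have UU : ospRel (-1) ospU ospU by relation.
have VV : ospRel (-1) ospV ospV by relation.
have UV : ospRel (-1) ospU ospV by relation.
have UU' : ospRel (-1) ospU ospU' by relation; rewrite acomm_u_uq.
have UV' : ospRel (-1) ospU ospV' by relation; rewrite acomm_u_vq.
have VU' : ospRel (-1) ospV ospU' by relation; rewrite acomm_v_uq.
have VV' : ospRel (-1) ospV ospV' by relation; rewrite acomm_v_vq.
have U'U' : ospRel (-1) ospU' ospU' by relation; rewrite (mulq_u q2 uq).
have U'V' : ospRel (-1) ospU' ospV'.
  by relation; rewrite (mulq_u q2 uq) (mulq_v q2 vq).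
have V'V' : ospRel (-1) ospV' ospV' by relation; rewrite (mulq_v q2 vq).
have VU := ospRel_sym (mkOsp_odd _ _ _ _) (mkOsp_odd _ _ _ _) UV.
have U'U := ospRel_sym (mkOsp_odd _ _ _ _) (mkOsp_odd _ _ _ _) UU'.
have V'U := ospRel_sym (mkOsp_odd _ _ _ _) (mkOsp_odd _ _ _ _) UV'.
have U'V := ospRel_sym (mkOsp_odd _ _ _ _) (mkOsp_odd _ _ _ _) VU'.
have V'V := ospRel_sym (mkOsp_odd _ _ _ _) (mkOsp_odd _ _ _ _) VV'.
have V'U' := ospRel_sym (mkOsp_odd _ _ _ _) (mkOsp_odd _ _ _ _) U'V'.
exact: (ospRel_oddl (ospRel_oddr UU UV UU' UV' gy) (ospRel_oddr VU VV VU' VV' gy)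
  (ospRel_oddr U'U U'V U'U' U'V' gy) (ospRel_oddr V'U V'V V'U' V'V' gy) gx).
Qed.

Lemma env_ospMap : exists f : {lrmorphism envAlg g -> B},
  forall x, f (envIn x) = ospMap x.
Proof.
apply: env_lift; first exact: ospMap_lin.
move=> p r x y gx gy; suff: ospRel ((-1) ^+ (p && r)) x y by [].
case: p gx; case: r gy => gy gx.
- exact: ospRel_odd_odd.
- exact: (ospRel_sym gy gx (ospRel_even_odd gy gx)).
- exact: ospRel_even_odd.
- exact: ospRel_even_even.
Qed.

(** Conjugation by [q] realises the parity automorphism on the image, so a scalar multiple of [q]
    can serve as the image of P. *)
Lemma ospMap_q p x : ls_gr p x -> q * ospMap x = (-1) ^+ p *: (ospMap x * q).
Proof.
have comm (a b : B) : a - b = 0 -> a = b by move=> /eqP; rewrite subr_eq0 => /eqP.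
have acomm (a b : B) : b + a = 0 -> a = - b.
  by move=> /eqP; rewrite addrC addr_eq0 => /eqP.
case: p => gx; last first.
  rewrite (osp_evenE gx) ospMap_mk !scale0r !addr0 scale1r.
  rewrite !mulrDr !mulrDl -!scalerAr -!scalerAl.
  rewrite (comm _ _ (comm_q_Y uq vq)) (comm _ _ (comm_q_H uq vq)).
  by rewrite (comm _ _ (comm_q_E uq)) (comm _ _ (comm_q_F vq)).
rewrite (osp_oddE gx) ospMap_mk !scale0r !add0r scaleN1r.
rewrite !mulrDr !mulrDl -!scalerAr -!scalerAl !opprD -!scalerN !mulrA.
by rewrite (acomm _ _ uq) (acomm _ _ vq) !mulNr.
Qed.

Lemma ospMapZ c x : ospMap (c *: x) = c *: ospMap x.
Proof. by rewrite -[c *: x]addr0 ospMap_lin ospMap0 addr0. Qed.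

End Hom.
End OspBasis.

(** * Invariant forms and the Casimir element *)

Section DualBases.
Context (K : fieldType) (V : lmodType K).

Lemma lin_sum (W : lmodType K) (f : V -> W) :
  (forall c x y, f (c *: x + y) = c *: f x + f y) ->
  forall n (a : 'I_n -> K) (x : 'I_n -> V),
  f (\sum_(i < n) a i *: x i) = \sum_(i < n) a i *: f (x i).
Proof.
move=> f_lin n a x.
have f0 : f 0 = 0 by have := f_lin (-1) 0 0; rewrite !scaleN1r !addNr.
elim/big_rec2: _ => // i w y _ <-; exact: f_lin.
Qed.

Context (B : V -> V -> K).
Hypothesis B_linl : forall c x y z, B (c *: x + y) z = c * B x z + B y z.
Hypothesis B_linr : forall c x y z, B x (c *: y + z) = c * B x y + B x z.
Hypothesis B_nondeg : forall x, (forall y, B x y = 0) -> x = 0.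

Definition dualBases d (u y : 'I_d -> V) :=
  (forall x, exists a : 'I_d -> K, x = \sum_(i < d) a i *: u i) /\
  forall i j, B (y i) (u j) = (i == j)%:R.

Lemma dualBases_expandr d (u y : 'I_d -> V) x :
  dualBases u y -> x = \sum_(i < d) B (y i) x *: u i.
Proof.
move=> [span dual]; have [a ->] := span x; apply: eq_bigr => i _.
rewrite (@lin_sum K^o _ (fun c x1 x2 => B_linr c (y i) x1 x2)).
congr (_ *: _); rewrite (bigD1 i) //= dual eqxx big1 ?addr0.
  by rewrite /GRing.scale /= mulr1.
by move=> j; rewrite eq_sym dual => /negbTE ->; rewrite scaler0.
Qed.

Lemma dualBases_expandl d (u y : 'I_d -> V) x :
  dualBases u y -> x = \sum_(i < d) B x (u i) *: y i.
Proof.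
move=> [span dual]; apply/eqP; rewrite -subr_eq0; apply/eqP.
(* By nondegeneracy it suffices that both sides pair equally with each [z], expanded in the
   [u i]. *)
apply: B_nondeg => z; have [a ->] := span z.
rewrite (@lin_sum K^o _ (fun c => B_linr c _)) big1 // => j _.
rewrite addrC -scaleN1r B_linl (@lin_sum K^o _ (fun c x y => B_linl c x y _)).
rewrite (bigD1 j) //= dual eqxx big1 => [|k kj]; last first.
  by rewrite dual (negbTE kj) scaler0.
by rewrite /GRing.scale /= addr0 mulr1 mulN1r addNr mulr0.
Qed.

(** Expand each [u i] in the [u' k] with coefficients [B (y' k) (u i)], exchange the sums, and
    recognise the expansion of [y' k] in the [y i]. *)
Lemma dualBases_indep (W : lmodType K) (M : V -> V -> W) d d'
    (u y : 'I_d -> V) (u' y' : 'I_d' -> V) :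
  (forall c x1 x2 z, M (c *: x1 + x2) z = c *: M x1 z + M x2 z) ->
  (forall c z x1 x2, M z (c *: x1 + x2) = c *: M z x1 + M z x2) ->
  dualBases u y -> dualBases u' y' ->
  \sum_(i < d) M (u i) (y i) = \sum_(k < d') M (u' k) (y' k).
Proof.
move=> Ml Mr uy uy'.
transitivity (\sum_(i < d) \sum_(k < d') B (y' k) (u i) *: M (u' k) (y i)).
  apply: eq_bigr => i _; rewrite {1}(dualBases_expandr (u i) uy').
  exact: (lin_sum (fun c x1 x2 => Ml c x1 x2 (y i))).
rewrite exchange_big; apply: eq_bigr => k _ /=.
rewrite [in RHS](dualBases_expandl (y' k) uy).
by rewrite (lin_sum (fun c => Mr c (u' k))).
Qed.

End DualBases.

(** * Invariant forms on osp(2,2) up to a scalar *)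

Section OspForm.
Context (K : numFieldType).
Local Notation g := (osp K 2 1).
Context (B : g -> g -> K).
Hypothesis Binv : isInvariantForm B.

Lemma form_0l x : B 0 x = 0.
Proof.
have := form_linl Binv (-1) 0 0 x.
by rewrite scaleN1r addNr mulN1r addNr.
Qed.

Lemma form_0r x : B x 0 = 0.
Proof.
have := form_linr Binv (-1) x 0 0.
by rewrite scaleN1r addNr mulN1r addNr.
Qed.

Lemma form_mkr x a h e f p q r s : B x (mkOsp a h e f p q r s) =
  a * B x (ospY K) + h * B x (ospH K) + e * B x (ospE K) + f * B x (ospF K)
  + p * B x (ospU K) + q * B x (ospV K) + r * B x (ospU' K) + s * B x (ospV' K).
Proof. by rewrite mkOspD !(form_linr Binv) form_0r addr0 !addrA. Qed.

Lemma form_mkl x a h e f p q r s : B (mkOsp a h e f p q r s) x =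
  a * B (ospY K) x + h * B (ospH K) x + e * B (ospE K) x + f * B (ospF K) x
  + p * B (ospU K) x + q * B (ospV K) x + r * B (ospU' K) x + s * B (ospV' K) x.
Proof. by rewrite mkOspD !(form_linl Binv) form_0l addr0 !addrA. Qed.

Let b := B (ospE K) (ospF K).

Lemma form_Z c x y : B (c *: x) y = c * B x y.
Proof. by rewrite -[c *: x]addr0 (form_linl Binv) form_0l addr0. Qed.

(* Invariance under the Cartan element ospH: the root vector ospE, of weight 2,
   only pairs with weight -2. *)
Lemma form_E_weight m y : ls_br (ospH K) y = m *: y -> m + 2%:R != 0 ->
  B (ospE K) y = 0.
Proof.
move=> Hy m2; have := form_inv Binv (ospE K) (ospH K) y.
have -> : ls_br (ospE K) (ospH K) = - 2%:R *: ospE K.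
  (* The added zero lets [mkOsp_lin] put the scalar multiple into coordinates. *)
  by rewrite ospBr_mk -[RHS]addr0 -mkOsp0 mkOsp_lin; congr mkOsp; ring.
rewrite Hy form_Z -[m *: y]addr0 (form_linr Binv) form_0r addr0 => /eqP.
by rewrite eq_sym -subr_eq0 -mulrBl opprK mulf_eq0 (negbTE m2) => /eqP.
Qed.

(** Among the basis vectors only [ospF] has weight -2 under [ospH]. *)
Lemma form_E a h e f p q r s : B (ospE K) (mkOsp a h e f p q r s) = b * f.
Proof.
have EY : B (ospE K) (ospY K) = 0.
  apply: (@form_E_weight 0); last by rewrite add0r pnatr_eq0.
  by rewrite ospBr_mk -[RHS]addr0 -mkOsp0 mkOsp_lin; congr mkOsp; ring.
have EH : B (ospE K) (ospH K) = 0.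
  apply: (@form_E_weight 0); last by rewrite add0r pnatr_eq0.
  by rewrite ospBr_mk -[RHS]addr0 -mkOsp0 mkOsp_lin; congr mkOsp; ring.
have EE : B (ospE K) (ospE K) = 0.
  apply: (@form_E_weight 2%:R); last by rewrite -natrD pnatr_eq0.
  by rewrite ospBr_mk -[RHS]addr0 -mkOsp0 mkOsp_lin; congr mkOsp; ring.
have EU : B (ospE K) (ospU K) = 0.
  apply: (@form_E_weight 1%:R); last by rewrite -natrD pnatr_eq0.
  by rewrite ospBr_mk -[RHS]addr0 -mkOsp0 mkOsp_lin; congr mkOsp; ring.
have EV : B (ospE K) (ospV K) = 0.
  apply: (@form_E_weight (- 1%:R)); last by rewrite addrC -natrB ?pnatr_eq0.
  by rewrite ospBr_mk -[RHS]addr0 -mkOsp0 mkOsp_lin; congr mkOsp; ring.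
have EU' : B (ospE K) (ospU' K) = 0.
  apply: (@form_E_weight 1%:R); last by rewrite -natrD pnatr_eq0.
  by rewrite ospBr_mk -[RHS]addr0 -mkOsp0 mkOsp_lin; congr mkOsp; ring.
have EV' : B (ospE K) (ospV' K) = 0.
  apply: (@form_E_weight (- 1%:R)); last by rewrite addrC -natrB ?pnatr_eq0.
  by rewrite ospBr_mk -[RHS]addr0 -mkOsp0 mkOsp_lin; congr mkOsp; ring.
by rewrite form_mkr EY EH EE EU EV EU' EV' -/b; ring.
Qed.

(** Starting from [ospE], brackets reach every other basis vector: [U = [E, V]], [U' = [E, V']], [H
    = [E, F]], [V = [U, -F]], [V' = [V, Y]], [Y = [U, -V']], [F = [V, V/2]]. Invariance moves the
    second factor to the other argument and reduces each value to [form_E]. *)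
Lemma form_mk a h e f p q r s a' h' e' f' p' q' r' s' :
  B (mkOsp a h e f p q r s) (mkOsp a' h' e' f' p' q' r' s') =
  b * ((a * a' + h * h' + p * q' - q * p' + r * s' - s * r') *+ 2
       + e * f' + f * e').
Proof.
set y := mkOsp a' h' e' f' p' q' r' s'.
have E := form_E.
have formU a0 h0 e0 f0 p0 q0 r0 s0 :
    B (ospU K) (mkOsp a0 h0 e0 f0 p0 q0 r0 s0) = b * q0 *+ 2.
  have -> : ospU K = ls_br (ospE K) (ospV K) by rewrite ospBr_mk; congr mkOsp; ring.
  by rewrite (form_inv Binv) ospBr_mk E; ring.
have formU' : B (ospU' K) y = b * s' *+ 2.
  have -> : ospU' K = ls_br (ospE K) (ospV' K).
    by rewrite ospBr_mk; congr mkOsp; ring.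
  by rewrite (form_inv Binv) ospBr_mk E; ring.
have formH : B (ospH K) y = b * h' *+ 2.
  have -> : ospH K = ls_br (ospE K) (ospF K) by rewrite ospBr_mk; congr mkOsp; ring.
  by rewrite (form_inv Binv) ospBr_mk E; ring.
have formV a0 h0 e0 f0 p0 q0 r0 s0 :
    B (ospV K) (mkOsp a0 h0 e0 f0 p0 q0 r0 s0) = - (b * p0 *+ 2).
  have -> : ospV K = ls_br (ospU K) (mkOsp 0 0 0 (-1) 0 0 0 0).
    by rewrite ospBr_mk; congr mkOsp; ring.
  by rewrite (form_inv Binv) ospBr_mk formU; ring.
have formV' : B (ospV' K) y = - (b * r' *+ 2).
  have -> : ospV' K = ls_br (ospV K) (mkOsp 1 0 0 0 0 0 0 0).
    by rewrite ospBr_mk; congr mkOsp; ring.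
  by rewrite (form_inv Binv) ospBr_mk formV; ring.
have formY : B (ospY K) y = b * a' *+ 2.
  have -> : ospY K = ls_br (ospU K) (mkOsp 0 0 0 0 0 0 0 (-1)).
    by rewrite ospBr_mk; congr mkOsp; ring.
  by rewrite (form_inv Binv) ospBr_mk formU; ring.
have formF : B (ospF K) y = b * e'.
  have -> : ospF K = ls_br (ospV K) (mkOsp 0 0 0 0 0 2%:R^-1 0 0).
    by rewrite ospBr_mk; congr mkOsp; field.
  by rewrite (form_inv Binv) ospBr_mk formV; field.
by rewrite form_mkl formU formU' formH formV formV' formY formF E; ring.
Qed.

(** Otherwise [ospE] would lie in the radical of the form. *)
Lemma form_EF_neq0 : b != 0.
Proof.
apply/eqP => b0; have /(congr1 (fun x : g => x i2 i3)) : ospE K = 0.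
  by apply: (form_nondeg Binv) => y; rewrite (osp_coords y) form_E b0 mul0r.
by rewrite !mxE /= => /eqP; rewrite oner_eq0.
Qed.

Definition ospBasis : 'I_8 -> g := fun k => nth 0 [:: ospY K; ospH K; ospE K;
  ospF K; ospU K; ospV K; ospU' K; ospV' K] k.

(** Read off from [form_mk]; the minus signs reflect the antisymmetry of the form on the odd
    part. *)
Definition ospDual : 'I_8 -> g := fun k => nth 0 [::
  (b *+ 2)^-1 *: ospY K; (b *+ 2)^-1 *: ospH K; b^-1 *: ospF K; b^-1 *: ospE K;
  - (b *+ 2)^-1 *: ospV K; (b *+ 2)^-1 *: ospU K;
  - (b *+ 2)^-1 *: ospV' K; (b *+ 2)^-1 *: ospU' K] k.

Lemma ospBasis_dual : dualBases B ospBasis ospDual.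
Proof.
split=> [x|].
  exists (fun k : 'I_8 => nth 0 [:: x i0 i1; x i2 i2; x i2 i3; x i3 i2;
    x i2 i0; x i3 i0; x i2 i1; x i3 i1] k).
  by rewrite {1}(osp_coords x) mkOspD !big_ord_recl big_ord0.
have b0 := form_EF_neq0.
move=> [[|[|[|[|[|[|[|[|i]]]]]]]] Hi] // [[|[|[|[|[|[|[|[|j]]]]]]]] Hj] //;
  rewrite /ospBasis /ospDual /= form_Z form_mk -?val_eqE /=;
  by field.
Qed.

End OspForm.

(** * Vanishing of the Casimir element, parity and surjectivity *)

Section Main.
Context (K : numFieldType).
Local Notation g := (osp K 2 1).

(** The sum is independent of the dual bases, and for [ospBasis] and [ospDual] it is a multiple of
    the expression in [casimir_eq0]. *)
Lemma ospMap_casimir (B : algType K) (u v q : B) (b : g -> g -> K)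
    d (x y : 'I_d -> g) :
  v * u * u - u * u * v - u = 0 -> v * v * u - u * v * v - v = 0 ->
  q * q + 1 = 0 -> u * q + q * u = 0 -> v * q + q * v = 0 ->
  isInvariantForm b -> dualBases b x y ->
  \sum_(i < d) ospMap u v q (x i) * ospMap u v q (y i) = 0.
Proof.
move=> uuv uvv q2 uq vq inv xy.
pose f := ospMap u v q; pose M x y := f x * f y.
have fM := @ospMap_lin K B u v q.
have Ml c x1 x2 z : M (c *: x1 + x2) z = c *: M x1 z + M x2 z.
  by rewrite /M /f fM mulrDl scalerAl.
have Mr c z x1 x2 : M z (c *: x1 + x2) = c *: M z x1 + M z x2.
  by rewrite /M /f fM mulrDr scalerAr.
have := dualBases_indep (form_linl inv) (form_linr inv) (form_nondeg inv)
  Ml Mr xy (ospBasis_dual inv).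
rewrite /M => ->; rewrite !big_ord_recl big_ord0 /ospBasis /ospDual /= /f.
rewrite !ospMapZ.
rewrite !ospMap_mk !(scale0r, scale1r, addr0, add0r) -!scalerAr.
have b0 := form_EF_neq0 inv; move: (b _ _) b0 => c c0.
(* Writing [1/c] as [1/(2c) + 1/(2c)] gives all terms the same coefficient; hence the doubled [E F]
   and [F E] in [casimir_eq0]. *)
have -> : c^-1 = (c *+ 2)^-1 + (c *+ 2)^-1 by field.
rewrite !(scalerDl, scaleNr) -!scalerDr -!scalerN -!scalerDr.
by rewrite casimir_eq0 ?scaler0.
Qed.

(** The sign rule passes from the Lie superalgebra to products, because degrees add and signs
    multiply. *)
Lemma env_parity (L : lieSuperalgebra K) (B : algType K)
    (f : {lrmorphism envAlg L -> B}) (w : B) :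
  (forall p x, ls_gr p x ->
     w * f (envIn x) = (-1) ^+ p *: (f (envIn x) * w)) ->
  forall p a, spanGr (@envIn K L) p a -> w * f a = (-1) ^+ p *: (f a * w).
Proof.
move=> fw p a; elim=> {p a} [p||p c a1 a2 _ h1 _ h2|p r x a gx _ h].
- by rewrite rmorph0 mulr0 mul0r scaler0.
- by rewrite rmorph1 mulr1 mul1r scale1r.
- rewrite linearP /= mulrDr mulrDl -scalerAr -scalerAl h1 h2 scalerDr.
  by rewrite !scalerA mulrC.
- rewrite rmorphM /= mulrA (fw _ _ gx) -scalerAl -[_ * w * f a]mulrA h.
  by rewrite -scalerAr scalerA signr_addb mulrA.
Qed.

Section Image.
Context (A B : algType K) (h : {lrmorphism A -> B}).

Definition inImage (b : B) : Prop := exists a, h a = b.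

Lemma inImage1 : inImage 1.
Proof. by exists 1; rewrite rmorph1. Qed.

Lemma inImage_lin c b1 b2 : inImage b1 -> inImage b2 -> inImage (c *: b1 + b2).
Proof. by move=> [a1 <-] [a2 <-]; exists (c *: a1 + a2); rewrite linearP. Qed.

Lemma inImageZ c b : inImage b -> inImage (c *: b).
Proof. by move=> [a <-]; exists (c *: a); rewrite linearZ. Qed.

Lemma inImageM b1 b2 : inImage b1 -> inImage b2 -> inImage (b1 * b2).
Proof. by move=> [a1 <-] [a2 <-]; exists (a1 * a2); rewrite rmorphM. Qed.

End Image.

Lemma smash_osp_onto (B : algType K) (t : ALgen -> B) (i : K) :
  i * i = -1 ->
  (forall x, t La * t x = t x * t La) -> t Om * t Om = 1 ->
  t Ep * t Om + t Om * t Ep = 0 -> t Em * t Om + t Om * t Em = 0 ->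
  t Ep * t Em - t Em * t Ep = - (4%:R^-1)%:A + t La * t Om ->
  (forall D : B -> Prop, D 1 ->
     (forall c a b, D a -> D b -> D (c *: a + b)) ->
     (forall x a, D a -> D (t x * a)) -> forall a, D a) ->
  exists f : {lrmorphism smash (envSuperalgebra g) -> B},
    (forall a : B, exists s, f s = a) /\
    forall (b : g -> g -> K) (c : envAlg g), isInvariantForm b ->
      isCasimir b c -> f (smashIn (A := envSuperalgebra g) c) = 0.
Proof.
move=> i2 la_c om2 ep_om em_om ep_em tind.
pose la := t La; pose om := t Om; pose ep := t Ep; pose em := t Em.
pose u := ep + ep; pose v := em; pose q := i *: om.
pose C : B := (4%:R^-1)%:A.
have C_em : C * em - em * C = 0 by rewrite /C mulr_algl mulr_algr subrr.
have C4 : C + C + C + C - 1 = 0.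
  rewrite /C -!scalerDl -[X in _ - X]scale1r -scalerBl.
  by rewrite (_ : _ - 1 = 0) ?scale0r //; field.
have la_ep : la * ep - ep * la = 0 by rewrite /la la_c subrr.
have la_em : la * em - em * la = 0 by rewrite /la la_c subrr.
have Z : ep * em - em * ep - (- C + la * om) = 0 by rewrite ep_em subrr.
have uuv : v * u * u - u * u * v - u = 0
  by exact: (commutator_uuv C4 la_ep ep_om Z).
have uvv : v * v * u - u * v * v - v = 0
  by exact: (commutator_uvv C_em C4 la_em em_om Z).
have q2 : q * q + 1 = 0.
  by rewrite /q -scalerAl -scalerAr scalerA i2 om2 scaleN1r addNr.
have uq : u * q + q * u = 0.
  rewrite /q /u -scalerAl -scalerAr -scalerDr mulrDl mulrDr addrACA ep_om.
  by rewrite addr0 scaler0.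
have vq : v * q + q * v = 0.
  by rewrite /q /v -scalerAl -scalerAr -scalerDr em_om scaler0.
have [f fE] := env_ospMap uuv uvv q2 uq vq.
have i_neq0 : i != 0.
  apply: contra_eqN i2 => /eqP ->.
  by rewrite mul0r eq_sym oppr_eq0 oner_eq0.
(* As [q = i om] with [i] invertible, the sign rule for [q] gives the one for [om]. *)
have fom p a : spanGr (@envIn K g) p a -> om * f a = (-1) ^+ p *: (f a * om).
  apply: env_parity => {a} {}p x gx; rewrite fE; apply: (scalerI i_neq0).
  by rewrite scalerAl (ospMap_q uq vq gx) -scalerAr !scalerA mulrC.
have [h [hE hP]] := @smash_lift K (envSuperalgebra g) B f om om2 fom.
exists h; split; last first.
  move=> b c inv [d [x [y [span dual ->]]]]; rewrite hE raddf_sum /=.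
  under eq_bigr => k _ do rewrite rmorphM /= !fE.
  exact: (ospMap_casimir uuv uvv q2 uq vq inv).
(* Surjectivity: the image contains [om] (from P), [em] (from [ospV]) and [ep] (half the image of
   [ospU]). *)
have him (x : g) : inImage h (ospMap u v q x).
  by exists (smashIn (A := envSuperalgebra g) (envIn x)); rewrite hE fE.
have om_im : inImage h om by exists (smashP _).
have em_im : inImage h em.
  have := him (ospV K); rewrite ospMap_mk.
  by rewrite !scale0r !addr0 !add0r scale1r.
have ep_im : inImage h ep.
  have := inImageZ 2%:R^-1 (him (ospU K)).
  rewrite ospMap_mk !scale0r !addr0 !add0r scale1r.
  rewrite /u -mulr2n -scaler_nat scalerA.
  by rewrite mulVf ?scale1r ?pnatr_eq0.
have la_im : inImage h la.
  (* The commutator relation solved for [la], using [om * om = 1]. *)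
  have -> : la = (4%:R^-1 *: 1 + (-1 *: (em * ep) + ep * em)) * om.
    rewrite scaleN1r [- _ + _]addrC ep_em addrA subrr add0r.
    by rewrite -mulrA om2 mulr1.
  apply: inImageM om_im; apply: inImage_lin; first exact: inImage1.
  by apply: inImage_lin; apply: inImageM.
apply: tind; [exact: inImage1 | exact: inImage_lin |].
by move=> x a; apply: inImageM; case: x.
Qed.

End Main.

Theorem proposition8p5 (R : realType) :
  exists f : {lrmorphism smash (envSuperalgebra (osp R[i] 2 1)) -> AL R[i]},
    (forall a : AL R[i], exists s, f s = a) /\
    forall (B : osp R[i] 2 1 -> osp R[i] 2 1 -> R[i])
           (c : envAlg (osp R[i] 2 1)),
      isInvariantForm B -> isCasimir B c ->
      f (smashIn (A := envSuperalgebra (osp R[i] 2 1)) c) = 0.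
Proof.
have [t [la_c om2 [ep_om em_om] ep_em tind]] := AL_generators R[i].
have i2 : 'i%C * 'i%C = -1 :> R[i] by rewrite -expr2 sqr_i.
exact: (smash_osp_onto i2 la_c om2 ep_om em_om ep_em tind).
Qed.
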